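(* Let $X$ be a nonreflexive Banach space and let $\mathcal{T}^*$ denote Tsirelson's space. Then $\mathcal{CR}(X,\mathcal{T}^* )\le 5$. In particular, one may take $X=c_0$ or $X=\ell_\infty$.
   Context: For metric spaces $(M_1,d_1)$, $(M_2,d_2)$ and an arbitrary (not necessarily continuous) map $\phi: M_1\to M_2$, define for $t\in(0,\infty)$ $$\kappa_\phi(t)=\inf_{d_1(x,y)\ge t} d_2(\phi(x),\phi(y)),\qquad \omega_\phi(t)=\sup_{d_1(x,y)\le t} d_2(\phi(x),\phi(y)),$$ with values in $[0,\infty]$, and $\kappa(\phi)=\sup_{t<\infty}\kappa_\phi(t)$, $\omega(\phi)=\inf_{t>0}\omega_\phi(t)$. The separation ratio of $\phi$ is $\mathcal{R}(\phi)=\kappa(\phi)/\omega(\phi)\in[0,\infty]$, with the conventions $\frac{a}{\infty}=\frac{0}{a}=0$ for all $a\in[0,\infty]$ and $\frac{a}{0}=\frac{\infty}{a}=\frac{\infty}{0}=\infty$ for all $a\in(0,\infty)$. The coarse embeddability ratio is $\mathcal{CR}(M_1,M_2)=\sup_\phi \mathcal{R}(\phi)$, the supremum over all maps $\phi:M_1\to M_2$. Banach spaces carry their norm metric. Tsirelson's space: A collection $\{I_1,\dots,I_m\}$ of disjoint intervals of natural numbers is admissible if $m<\min(I_k)$ for $1\le k\le m$. On the space $c_{00}$ of finitely supported real sequences put $\|x\|_0=\|x\|_{c_0}$ (the sup norm) and, for $n\in\mathbb{N}$, $$\|x\|_n=\max\Big\{\|x\|_{n-1},\ \sup\tfrac12\sum_{j=1}^m\|P_{I_j}x\|_{n-1}\Big\},$$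 the supremum over all admissible families of intervals, where $P_{I}x$ is the projection of $x$ onto the coordinates in $I$. Set $\|x\|_{\mathcal{T}}=\sup_{n\ge0}\|x\|_n$, and let $\mathcal{T}$ be the completion of $c_{00}$ under $\|\cdot\|_{\mathcal{T}}$. Tsirelson's space $\mathcal{T}^*$ is the dual of $\mathcal{T}$. *)

(* Defs.v *)
From HB Require Import structures.
From mathcomp Require Import all_boot all_order all_algebra.
From mathcomp Require Import generic_quotient ring_quotient.
From mathcomp Require Import all_classical all_reals all_analysis.
From mathcomp Require Import lra.

Set Implicit Arguments.
Unset Strict Implicit.
Unset Printing Implicit Defensive.

Import Order.TTheory GRing.Theory Num.Theory.
Import numFieldNormedType.Exports.

Local Open Scope classical_set_scope.
Local Open Scope ring_scope.
Local Open Scope quotient_scope.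

(* The infima and suprema are taken in \bar R; for inhabited spaces they lie
   in [0, +oo]. *)
Section coarse_ratio.
Context {R : realType} {M1 M2 : metricType R}.

Definition compression (phi : M1 -> M2) (t : R) : \bar R :=
  ereal_inf [set (mdist (phi p.1) (phi p.2))%:E
            | p in [set p : M1 * M1 | t <= mdist p.1 p.2]].

Definition expansion (phi : M1 -> M2) (t : R) : \bar R :=
  ereal_sup [set (mdist (phi p.1) (phi p.2))%:E
            | p in [set p : M1 * M1 | mdist p.1 p.2 <= t]].

Definition kappa (phi : M1 -> M2) : \bar R :=
  ereal_sup [set compression phi t | t in [set t : R | 0 < t]].

Definition omega (phi : M1 -> M2) : \bar R :=
  ereal_inf [set expansion phi t | t in [set t : R | 0 < t]].

(* On [0, +oo], division in \bar R follows the conventions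
   a / +oo = 0 / a = 0 for all a, and a / 0 = +oo / a = +oo / 0 = +oo for
   0 < a < +oo, as the facts below check. *)
Definition separation_ratio (phi : M1 -> M2) : \bar R :=
  (kappa phi / omega phi)%E.

End coarse_ratio.

Definition coarse_embeddability_ratio {R : realType} (M1 M2 : metricType R) : \bar R :=
  ereal_sup (range (fun phi : M1 -> M2 => separation_ratio phi)).

Section division_conventions.
Context {R : realType}.
Local Open Scope ereal_scope.

Fact div_pinfty (a : \bar R) : a / +oo = 0.
Proof. by rewrite invey mule0. Qed.

Fact div0_ereal (a : \bar R) : 0 / a = 0.
Proof. by rewrite mul0e. Qed.

Fact div_by0 (a : \bar R) : 0 < a -> a / 0 = +oo.
Proof. by move=> a0; rewrite inve0 gt0_muley. Qed.

Fact pinfty_div (a : R) : (0 < a)%R -> +oo / a%:E = +oo.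
Proof. by move=> a0; rewrite inver gt_eqF// gt0_mulye// lte_fin invr_gt0. Qed.

End division_conventions.

(* A normed module seen as a metric space. *)
Definition norm_metric {R : realType} (V : normedModType R) : Type := V.

Section norm_metric.
Context {R : realType} (V : normedModType R).

HB.instance Definition _ := PseudoMetric.copy (norm_metric V) V.

Let dist (x y : norm_metric V) : R := `|(x : V) - y|.

Let dist_ge0 x y : 0 <= dist x y.
Proof. exact: normr_ge0. Qed.

Let dist_positivity x y : dist x y = 0 -> x = y.
Proof. by move/normr0_eq0/eqP; rewrite subr_eq0 => /eqP. Qed.

Let ballEdist (x : norm_metric V) d : ball x d = [set y | dist x y < d].
Proof. by rewrite -[LHS]/(@ball R V x d) -ball_normE. Qed.

HB.instance Definition _ := @PseudoMetric_isMetric.Build R (norm_metric V)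
  dist dist_ge0 dist_positivity ballEdist.

End norm_metric.

Section dual.
Context {R : realType} (V : normedModType R).

Definition dual_pred : {pred V -> R} :=
  fun f => `[< linear f /\ continuous f >].

Lemma dual_predP (f : V -> R) :
  f \in dual_pred <-> linear f /\ exists C, forall x, `|f x| <= C * `|x|.
Proof.
split=> [/asboolP[lf cf]|[lf [C fC]]].
  split=> //.
  pose F := GRing.isLinear.Build _ _ _ _ f lf.
  pose g : {linear V -> R} := HB.pack f F.
  have /linear_boundedP : bounded_near g (nbhs 0).
    by apply/linear_bounded_continuous.
  by move=> /pinfty_ex_gt0 [C _ fC]; exists C.
apply/asboolP; split=> //.
pose F := GRing.isLinear.Build _ _ _ _ f lf.
pose g : {linear V -> R} := HB.pack f F.
apply: (@bounded_linear_continuous _ _ _ g); apply/linear_boundedP.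
near=> r => x; apply: le_trans (fC x) _.
by rewrite ler_wpM2r//; near: r; exact: nbhs_pinfty_ge.
Unshelve. all: by end_near. Qed.

Lemma dual_submod_closed : submod_closed dual_pred.
Proof.
split=> [|a f g].
  apply/dual_predP; split=> [c x y|]; first by rewrite scaler0 addr0.
  by exists 0 => x; rewrite normr0 mul0r.
move=> /dual_predP[lf [C fC]] /dual_predP[lg [D gD]].
apply/dual_predP; split=> [c x y|].
  rewrite /= !fctE lf lg !scalerDr !scalerA mulrC -!addrA.
  by congr (_ + _); rewrite addrCA.
exists (`|a| * C + D) => x; rewrite mulrDl -mulrA.
apply: le_trans (ler_normD _ _) _; apply: lerD => //.
by rewrite normrM ler_wpM2l.
Qed.

HB.instance Definition _ :=
  GRing.isSubmodClosed.Build R (V -> R) dual_pred dual_submod_closed.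

Record dual_space := Dual { dual_val :> V -> R ; _ : dual_val \in dual_pred }.

HB.instance Definition _ := [isSub for dual_val].
HB.instance Definition _ := [Choice of dual_space by <:].
HB.instance Definition _ := [SubChoice_isSubLmodule of dual_space by <:].

Implicit Types (f g : dual_space) (x y : V).

Definition dual_norm f : R := sup [set `|f x| | x in [set x | `|x| <= 1]].

Let ball_nonempty f : [set `|f x| | x in [set x | `|x| <= 1]] !=set0.
Proof. by exists `|f 0|, 0 => //=; rewrite normr0. Qed.

Let dualP f : linear f /\ exists C, forall x, `|f x| <= C * `|x|.
Proof. by apply/dual_predP; case: f. Qed.

Lemma dualZ f a x : f (a *: x) = a * f x.
Proof.
have [lf _] := dualP f.
have f0 : f 0 = 0 by have := lf (-1) 0 0; rewrite scaler0 addr0 scaleN1r addNr.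
by rewrite -[a *: x]addr0 lf f0 addr0.
Qed.

Lemma dualD f x y : f (x + y) = f x + f y.
Proof. by have [lf _] := dualP f; rewrite -[x]scale1r lf scale1r scale1r. Qed.

Lemma dual_norm_has_ubound f :
  has_ubound [set `|f x| | x in [set x | `|x| <= 1]].
Proof.
have [_ [C fC]] := dualP f; exists `|C| => _ [x /= x1 <-].
apply: le_trans (fC x) _; apply: le_trans (ler_norm _) _.
by rewrite normrM normr_id ler_piMr.
Qed.

Lemma dual_norm_ub f x : `|x| <= 1 -> `|f x| <= dual_norm f.
Proof.
by move=> x1; apply: ub_le_sup; [exact: dual_norm_has_ubound|exists x].
Qed.

Lemma dual_norm_le f C : (forall x, `|x| <= 1 -> `|f x| <= C) ->
  dual_norm f <= C.
Proof. by move=> fC; apply: ge_sup => // _ [x /= x1 <-]; exact: fC. Qed.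

Lemma dual_norm_bound f x : `|f x| <= dual_norm f * `|x|.
Proof.
have [->|x0] := eqVneq x 0.
  by rewrite -(scale0r 0) dualZ mul0r normr0 scale0r normr0 mulr0.
have nx0 : 0 < `|x| by rewrite normr_gt0.
rewrite -ler_pdivrMr// mulrC -[X in X * _](@ger0_norm _ `|x|^-1) ?invr_ge0//.
rewrite -normrM -dualZ; apply: dual_norm_ub.
by rewrite normrZ ger0_norm ?invr_ge0// mulVf ?gt_eqF.
Qed.

Let dual_normD f g : dual_norm (f + g) <= dual_norm f + dual_norm g.
Proof.
apply: dual_norm_le => x x1; apply: le_trans (ler_normD _ _) _.
by apply: lerD; exact: dual_norm_ub.
Qed.

Let dual_normZ a f : dual_norm (a *: f) = `|a| * dual_norm f.
Proof.
have le b h : dual_norm (b *: h) <= `|b| * dual_norm h.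
  apply: dual_norm_le => x x1.
  by rewrite [_ x]/(b * h x) normrM ler_wpM2l// dual_norm_ub.
apply/eqP; rewrite eq_le le/=; have [->|a0] := eqVneq a 0.
  rewrite normr0 mul0r; apply: le_trans (dual_norm_ub _ (x := 0) _) => //.
  by rewrite normr0.
rewrite -ler_pdivlMl ?normr_gt0// -normfV.
by apply: le_trans (le _ _); rewrite scalerA mulVf// scale1r.
Qed.

Let dual_norm0_eq0 f : dual_norm f = 0 -> f = 0.
Proof.
move=> f0; apply/val_inj/funext => x; apply/eqP; rewrite -normr_le0.
by apply: le_trans (dual_norm_bound f x) _; rewrite f0 mul0r.
Qed.

HB.instance Definition _ := Lmodule_isNormed.Build R dual_space
  dual_normD dual_normZ dual_norm0_eq0.

End dual.

Definition reflexive_space {R : realType} (V : normedModType R) : Prop :=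
  forall Phi : dual_space (dual_space V), exists x : V,
  forall f : dual_space V, Phi f = f x.

Lemma invS_le {R : realType} (e : R) : 0 < e ->
  exists N, forall n : nat, (N <= n)%N -> n.+1%:R^-1 <= e.
Proof.
move=> e0; exists (Num.truncn e^-1) => n Nn.
rewrite -[leRHS]invrK lef_pV2 ?posrE ?invr_gt0//.
by apply/ltW; apply: lt_le_trans (truncnS_gt _) _; rewrite ler_nat ltnS.
Qed.

(* Filter completeness of a normed module from sequential completeness. *)
Section sequential_completeness.
Context {R : realType} (V : normedModType R).

Definition cauchy_sequence (u : nat -> V) : Prop :=
  forall e : R, 0 < e -> exists N, forall m n, (N <= m)%N -> (N <= n)%N ->
  `|u m - u n| <= e.

Lemma sequentially_complete :
  (forall u : nat -> V, cauchy_sequence u -> exists l : V,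
     forall e : R, 0 < e -> exists N, forall n, (N <= n)%N -> `|u n - l| <= e) ->
  forall F : set_system V, ProperFilter F -> cauchy F -> cvg F.
Proof.
move=> sc F FF /cauchyP Fc.
have /choice[u uF] n : exists x, F (ball x (n.+1%:R^-1 : R)).
  by apply: Fc; rewrite invr_gt0.
have close m n : `|u m - u n| <= m.+1%:R^-1 + n.+1%:R^-1.
  have [x [xm xn]] := filter_ex (filterI (uF m) (uF n)).
  move: xm xn; rewrite -!ball_normE /= => xm xn.
  rewrite -(subrKA x); apply: le_trans (ler_normD _ _) _.
  by rewrite lerD// ltW// distrC.
have [e e0|l ul] := sc u.
  have [|N HN] := invS_le (e := e / 2); first by rewrite divr_gt0.
  exists N => m n Nm Nn; apply: le_trans (close m n) _.
  by rewrite [leRHS]splitr lerD// HN.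
apply/cvg_ex; exists l; apply/cvgrPdist_le => e e0.
have e20 : 0 < e / 2 by rewrite divr_gt0.
have [N HN] := invS_le e20; have [N' HN'] := ul _ e20.
near=> x; rewrite -(subrKA (u (maxn N N'))); apply: le_trans (ler_normD _ _) _.
rewrite [leRHS]splitr lerD//; first by rewrite distrC HN'// leq_maxr.
apply: (@le_trans _ _ (maxn N N').+1%:R^-1); last by rewrite HN// leq_maxl.
apply/ltW; near: x; have := uF (maxn N N').
by apply: filterS => x; rewrite -ball_normE.
Unshelve. all: by end_near. Qed.

End sequential_completeness.

Definition sup_norm {R : realType} (x : nat -> R) : R :=
  sup (range (fun i => `|x i|)).

Section sup_norm.
Context {R : realType}.
Implicit Types x y : nat -> R.

Lemma sup_norm_ub x C i : (forall i, `|x i| <= C) -> `|x i| <= sup_norm x.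
Proof.
by move=> xC; apply: ub_le_sup; [exists C => _ [j _ <-]|exists i].
Qed.

Lemma sup_norm_le x C : (forall i, `|x i| <= C) -> sup_norm x <= C.
Proof.
by move=> xC; apply: ge_sup => [|_ [j _ <-]//]; exists `|x 0|, 0%N.
Qed.

Lemma sup_normD x y C D : (forall i, `|x i| <= C) -> (forall i, `|y i| <= D) ->
  sup_norm (x + y) <= sup_norm x + sup_norm y.
Proof.
move=> xC yD; apply: sup_norm_le => i; apply: le_trans (ler_normD _ _) _.
by apply: lerD; [exact: sup_norm_ub xC|exact: sup_norm_ub yD].
Qed.

Lemma sup_normZ x C a : (forall i, `|x i| <= C) ->
  sup_norm (a *: x) = `|a| * sup_norm x.
Proof.
move=> xC; have le b y D : (forall i, `|y i| <= D) ->
    sup_norm (b *: y) <= `|b| * sup_norm y.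
  move=> yD; apply: sup_norm_le => i; rewrite [_ i]/(b * y i) normrM.
  by rewrite ler_wpM2l//; exact: sup_norm_ub yD.
apply/eqP; rewrite eq_le (le _ _ _ xC)/=; have [->|a0] := eqVneq a 0.
  rewrite normr0 mul0r scale0r; apply: le_trans (sup_norm_ub (C := 0) 0%N _) => //.
  by move=> i; rewrite normr0.
rewrite -ler_pdivlMl ?normr_gt0// -normfV.
apply: le_trans (le _ _ (`|a| * C) _); first by rewrite scalerA mulVf// scale1r.
by move=> i; rewrite [_ i]/(a * x i) normrM ler_wpM2l.
Qed.

Lemma sup_norm0_eq0 x C : (forall i, `|x i| <= C) -> sup_norm x = 0 -> x = 0.
Proof.
move=> xC x0; apply/funext => i; apply/eqP; rewrite -normr_le0 -x0.
exact: sup_norm_ub xC.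
Qed.

End sup_norm.

Section linf.
Context {R : realType}.

Definition linf_pred : {pred nat -> R} :=
  fun x => `[< exists C, forall i, `|x i| <= C >].

Lemma linf_submod_closed : submod_closed linf_pred.
Proof.
split=> [|a x y /asboolP[C xC] /asboolP[D yD]]; apply/asboolP.
  by exists 0 => i; rewrite normr0.
exists (`|a| * C + D) => i; apply: le_trans (ler_normD _ _) _.
by rewrite lerD// normrM ler_wpM2l.
Qed.

HB.instance Definition _ :=
  GRing.isSubmodClosed.Build R (nat -> R) linf_pred linf_submod_closed.

Record linf := Linf { linf_val :> nat -> R ; _ : linf_val \in linf_pred }.

HB.instance Definition _ := [isSub for linf_val].
HB.instance Definition _ := [Choice of linf by <:].
HB.instance Definition _ := [SubChoice_isSubLmodule of linf by <:].

Implicit Types x y : linf.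

Lemma linf_bounded x : exists C, forall i, `|x i| <= C.
Proof. by apply/asboolP; case: x. Qed.

Let linf_normD x y : sup_norm (x + y) <= sup_norm x + sup_norm y.
Proof.
have [C xC] := linf_bounded x; have [D yD] := linf_bounded y.
exact: sup_normD xC yD.
Qed.

Let linf_normZ a x : sup_norm (a *: x) = `|a| * sup_norm x.
Proof. by have [C xC] := linf_bounded x; exact: sup_normZ xC. Qed.

Let linf_norm0_eq0 x : sup_norm x = 0 -> x = 0.
Proof.
by have [C xC] := linf_bounded x => /(sup_norm0_eq0 xC) x0; exact: val_inj.
Qed.

HB.instance Definition _ := Lmodule_isNormed.Build R linf
  linf_normD linf_normZ linf_norm0_eq0.

Lemma linf_normE x : `|x| = sup_norm x. Proof. by []. Qed.

Lemma linf_norm_ub x i : `|x i| <= `|x|.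
Proof. by have [C xC] := linf_bounded x; exact: sup_norm_ub xC. Qed.

Lemma linf_complete (F : set_system linf) : ProperFilter F -> cauchy F -> cvg F.
Proof.
apply: sequentially_complete => u uc.
have uc' i : cvgn (fun n => u n i).
  apply/cauchy_cvgP/cauchyP => e e0.
  have [|N HN] := uc (e / 2); first by rewrite divr_gt0.
  exists (u N i); exists N => // n /= Nn; rewrite -ball_normE /=.
  apply: le_lt_trans (linf_norm_ub (u N - u n) i) _.
  apply: (@le_lt_trans _ _ (e / 2)); last by rewrite gtr_pMr// invf_lt1// ltr1n.
  exact: HN.
pose l i := limn (fun n => u n i).
have ul e : 0 < e ->
    exists N, forall n, (N <= n)%N -> forall i, `|u n i - l i| <= e.
  move=> e0; have [N HN] := uc _ e0; exists N => n Nn i.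
  have cv : `|u n i - u m i| @[m --> \oo] --> `|u n i - l i|.
    by apply: cvg_norm; apply: cvgB; [exact: cvg_cst|exact: uc'].
  rewrite -(cvg_lim _ cv)//; apply: limr_le; first by apply/cvg_ex; eexists; exact: cv.
  near=> m; apply: le_trans (linf_norm_ub (u n - u m) i) _.
  by apply: HN => //; near: m; exact: nbhs_infty_ge.
have linfl : l \in linf_pred.
  have [N HN] := ul _ ltr01; apply/asboolP; exists (`|u N| + 1) => i.
  rewrite -[l i](subKr (u N i)); apply: le_trans (ler_normB _ _) _.
  by rewrite lerD ?HN// linf_norm_ub.
exists (Linf linfl) => e e0; have [N HN] := ul _ e0; exists N => n Nn.
exact: (sup_norm_le (HN n Nn)).
Unshelve. all: by end_near. Qed.

HB.instance Definition _ := Uniform_isComplete.Build linf linf_complete.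

End linf.
Arguments linf R : clear implicits.

Section c0.
Context {R : realType}.

Definition c0_pred : {pred nat -> R} := fun x => `[< x @ \oo --> (0 : R) >].

Lemma c0_submod_closed : submod_closed c0_pred.
Proof.
split=> [|a x y /asboolP x0 /asboolP y0]; apply/asboolP; first exact: cvg_cst.
rewrite -(addr0 0) -{1}(mulr0 a); apply: cvgD => //.
by apply: cvgM => //; exact: cvg_cst.
Qed.

HB.instance Definition _ :=
  GRing.isSubmodClosed.Build R (nat -> R) c0_pred c0_submod_closed.

Record c0 := C0 { c0_val :> nat -> R ; _ : c0_val \in c0_pred }.

HB.instance Definition _ := [isSub for c0_val].
HB.instance Definition _ := [Choice of c0 by <:].
HB.instance Definition _ := [SubChoice_isSubLmodule of c0 by <:].

Implicit Types x y : c0.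

Lemma c0_cvg x : x @ \oo --> (0 : R).
Proof. by apply/asboolP; case: x. Qed.

Lemma c0_bounded x : exists C, forall i, `|x i| <= C.
Proof.
have : cvgn x by apply/cvg_ex; exists 0; exact: c0_cvg.
move=> /cvg_seq_bounded/pinfty_ex_gt0[C _ xC]; exists C => i.
exact: xC.
Qed.

Let c0_normD x y : sup_norm (x + y) <= sup_norm x + sup_norm y.
Proof.
have [C xC] := c0_bounded x; have [D yD] := c0_bounded y.
exact: sup_normD xC yD.
Qed.

Let c0_normZ a x : sup_norm (a *: x) = `|a| * sup_norm x.
Proof. by have [C xC] := c0_bounded x; exact: sup_normZ xC. Qed.

Let c0_norm0_eq0 x : sup_norm x = 0 -> x = 0.
Proof.
by have [C xC] := c0_bounded x => /(sup_norm0_eq0 xC) x0; exact: val_inj.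
Qed.

HB.instance Definition _ := Lmodule_isNormed.Build R c0
  c0_normD c0_normZ c0_norm0_eq0.

Lemma c0_normE x : `|x| = sup_norm x. Proof. by []. Qed.

Lemma c0_complete (F : set_system c0) : ProperFilter F -> cauchy F -> cvg F.
Proof.
apply: sequentially_complete => u uc.
have uinf n : c0_val (u n) \in linf_pred by apply/asboolP; exact: c0_bounded.
pose v n : linf R := Linf (uinf n).
have vc : cvgn v.
  apply/cauchy_cvgP/cauchyP => e e0.
  have [|N HN] := uc (e / 2); first by rewrite divr_gt0.
  exists (v N); exists N => // n /= Nn; rewrite -ball_normE /=.
  apply: (@le_lt_trans _ _ (e / 2)); last by rewrite gtr_pMr// invf_lt1// ltr1n.
  exact: HN.
have vl e : 0 < e -> exists N, forall n, (N <= n)%N -> `|v n - limn v| <= e.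
  by move=> e0; have /cvgrPdistC_le/(_ _ e0)[N _ HN] := vc; exists N.
have lc0 : linf_val (limn v) \in c0_pred.
  apply/asboolP/cvgrPdistC_le => e e0.
  have [|N HN] := vl (e / 2); first by rewrite divr_gt0.
  have /cvgrPdistC_le/(_ (e / 2)) := c0_cvg (u N).
  rewrite divr_gt0// => /(_ isT)[M _ HM]; exists M => // i /= Mi.
  rewrite subr0 -[X in `|X|](subKr (u N i)).
  apply: le_trans (ler_normB _ _) _; rewrite [leRHS]splitr lerD//.
    by rewrite -[u N i]subr0; exact: HM.
  exact: le_trans (linf_norm_ub (v N - limn v) i) (HN _ _).
exists (C0 lc0) => e /vl[N HN]; exists N => n; exact: HN.
Qed.

HB.instance Definition _ := Uniform_isComplete.Build c0 c0_complete.

End c0.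
Arguments c0 R : clear implicits.

(* The finitely supported sequences (x_1, x_2, ...); the term x_(i+1) is
   stored at index i, since the natural numbers start from 1 here. *)
Section c00.
Context {R : realType}.

Definition c00_pred : {pred nat -> R} :=
  fun x => `[< exists N, forall i, (N <= i)%N -> x i = 0 >].

Lemma c00_submod_closed : submod_closed c00_pred.
Proof.
split=> [|a x y /asboolP[N xN] /asboolP[M yM]]; apply/asboolP.
  by exists 0%N.
exists (maxn N M) => i; rewrite geq_max => /andP[Ni Mi].
have -> : (a *: x + y) i = a * x i + y i by [].
rewrite (xN _ Ni) (yM _ Mi) mulr0.
exact: addr0.
Qed.

HB.instance Definition _ :=
  GRing.isSubmodClosed.Build R (nat -> R) c00_pred c00_submod_closed.

Record c00 := C00 { c00_val :> nat -> R ; _ : c00_val \in c00_pred }.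

HB.instance Definition _ := [isSub for c00_val].
HB.instance Definition _ := [Choice of c00 by <:].
HB.instance Definition _ := [SubChoice_isSubLmodule of c00 by <:].

Lemma c00_finite_support (x : c00) :
  exists N, forall i, (N <= i)%N -> x i = 0.
Proof. by apply/asboolP; case: x. Qed.

Lemma c00_proj_subproof (I : interval nat) (x : c00) :
  (fun i => if i.+1 \in I then x i else 0) \in c00_pred.
Proof.
have [N xN] := c00_finite_support x; apply/asboolP; exists N => i /xN ->.
exact: if_same.
Qed.

Definition c00_proj (I : interval nat) (x : c00) : c00 :=
  C00 (c00_proj_subproof I x).

End c00.
Arguments c00 R : clear implicits.

Definition admissible (m : nat) (I : 'I_m -> interval nat) : Prop :=
  [/\ forall k, exists i, i \in I k,
      forall k l i, k != l -> ~ (i \in I k /\ i \in I l) &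
      forall k i, i \in I k -> (m < i)%N].

Section tsirelson_norm.
Context {R : realType}.
Implicit Types x y : c00 R.

Fixpoint tsirelson_norm_ (n : nat) (x : c00 R) : R :=
  if n is n'.+1 then
    Num.max (tsirelson_norm_ n' x)
      (sup [set r | exists (m : nat) (I : 'I_m -> interval nat),
        admissible I /\
        r = 2^-1 * \sum_(k < m) tsirelson_norm_ n' (c00_proj (I k) x)])
  else sup_norm x.

Definition tsirelson_norm x : R := sup (range (tsirelson_norm_ ^~ x)).

Local Notation tn := tsirelson_norm_.

Let sums n x := [set r | exists (m : nat) (I : 'I_m -> interval nat),
  admissible I /\ r = 2^-1 * \sum_(k < m) tn n (c00_proj (I k) x)].

Let sums_nonempty n x : sums n x !=set0.
Proof.
exists 0, 0%N, (fun=> `]-oo, +oo[%R); split; last by rewrite big_ord0 mulr0.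
by split=> [[]|[]|[]].
Qed.

Let l1 N x := \sum_(i < N) `|x i|.

Let tn_le_l1 n N x : (forall i, (N <= i)%N -> x i = 0) ->
  tn n x <= l1 N x /\ has_ubound (sums n x).
Proof.
have step n' : (forall x, (forall i, (N <= i)%N -> x i = 0) ->
      tn n' x <= l1 N x) ->
    forall x, (forall i, (N <= i)%N -> x i = 0) -> ubound (sums n' x) (l1 N x).
  move=> IH {}x xN _ [m [I [[_ dI _] ->]]].
  have le : \sum_(k < m) tn n' (c00_proj (I k) x) <= l1 N x.
    apply: (@le_trans _ _ (\sum_(k < m) l1 N (c00_proj (I k) x))).
      by apply: ler_sum => k _; apply: IH => i Ni /=; rewrite xN// if_same.
    rewrite exchange_big/=; apply: ler_sum => i _.
    have [[k ik]|noI] := pselect (exists k, i.+1 \in I k).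
      rewrite (bigD1 k)//= ik big1 ?addr0// => l lk.
      case: ifPn => [il|_]; last by rewrite normr0.
      by have := dI _ _ _ lk (conj il ik).
    rewrite big1// => k _ /=; case: ifPn => [ik|_]; last by rewrite normr0.
    by case: noI; exists k.
  have l10 : 0 <= l1 N x by apply: sumr_ge0.
  rewrite ler_pdivrMl//; apply: le_trans le _.
  by rewrite mulr_natl mulr2n lerDr.
have main n' : forall x, (forall i, (N <= i)%N -> x i = 0) -> tn n' x <= l1 N x.
  elim: n' => [|n' IH] {}x xN /=.
    apply: sup_norm_le => i; have [iN|/xN ->] := ltnP i N.
      by rewrite /l1 (bigD1 (Ordinal iN))//= lerDl sumr_ge0.
    by rewrite normr0 sumr_ge0.
  by rewrite ge_max IH//=; apply: ge_sup; [exact: sums_nonempty|exact: step].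
by move=> xN; split; [exact: main|exists (l1 N x); exact: (step n (main n) x xN)].
Qed.

Lemma tsirelson_norm_sums_has_ubound n x : has_ubound (sums n x).
Proof. by have [N /(tn_le_l1 n)[]] := c00_finite_support x. Qed.

Lemma tsirelson_norm_has_ubound x : has_ubound (range (tn ^~ x)).
Proof.
have [N xN] := c00_finite_support x.
by exists (l1 N x) => _ [n _ <-]; case: (tn_le_l1 n xN).
Qed.

Let c00_bounded x : exists C, forall i, `|x i| <= C.
Proof.
have [N xN] := c00_finite_support x; exists (l1 N x) => i.
have [iN|/xN ->] := ltnP i N; last by rewrite normr0 sumr_ge0.
by rewrite /l1 (bigD1 (Ordinal iN))//= lerDl sumr_ge0.
Qed.

Let c00_projD I x y : c00_proj I (x + y) = c00_proj I x + c00_proj I y.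
Proof.
apply/val_inj/funext => i /=; rewrite [RHS]/(c00_proj I x i + c00_proj I y i) /=.
by case: ifP => _ //; exact: (esym (addr0 (0 : R))).
Qed.

Let c00_projZ I a x : c00_proj I (a *: x) = a *: c00_proj I x.
Proof.
apply/val_inj/funext => i /=; rewrite [RHS]/(a * c00_proj I x i) /=.
by case: ifP => _ //; exact: (esym (mulr0 a)).
Qed.

Let tnD n x y : tn n (x + y) <= tn n x + tn n y.
Proof.
elim: n x y => [|n IH] x y /=.
  have [C xC] := c00_bounded x; have [D yD] := c00_bounded y.
  exact: sup_normD xC yD.
rewrite ge_max (le_trans (IH x y)) ?lerD ?le_max ?lexx//=.
apply: ge_sup; first exact: sums_nonempty.
move=> _ [m [I [aI ->]]].
apply: (@le_trans _ _ (2^-1 * \sum_(k < m) tn n (c00_proj (I k) x) +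
                       2^-1 * \sum_(k < m) tn n (c00_proj (I k) y))).
  rewrite -mulrDr ler_wpM2l// -big_split/=; apply: ler_sum => k _.
  by rewrite c00_projD.
apply: lerD; rewrite le_max; apply/orP; right; apply: ub_le_sup.
- exact: tsirelson_norm_sums_has_ubound.
- by exists m, I.
- exact: tsirelson_norm_sums_has_ubound.
- by exists m, I.
Qed.

Let tnZ_le n a x : tn n (a *: x) <= `|a| * tn n x.
Proof.
elim: n a x => [|n IH] a x /=.
  by have [C xC] := c00_bounded x; rewrite (sup_normZ a xC).
rewrite ge_max (le_trans (IH a x)) ?ler_wpM2l ?le_max ?lexx//=.
apply: ge_sup; first exact: sums_nonempty.
move=> _ [m [I [aI ->]]].
apply: (@le_trans _ _ (`|a| * (2^-1 * \sum_(k < m) tn n (c00_proj (I k) x)))).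
  rewrite mulrCA ler_wpM2l// mulr_sumr; apply: ler_sum => k _.
  by rewrite c00_projZ.
rewrite ler_wpM2l// le_max; apply/orP; right; apply: ub_le_sup.
  exact: tsirelson_norm_sums_has_ubound.
by exists m, I.
Qed.

Lemma tsirelson_norm_ge n x : tn n x <= tsirelson_norm x.
Proof.
by apply: ub_le_sup; [exact: tsirelson_norm_has_ubound|exists n].
Qed.

Let range_nonempty x : range (tn ^~ x) !=set0.
Proof. by exists (tn 0 x), 0%N. Qed.

Let tsirelson_normD x y :
  tsirelson_norm (x + y) <= tsirelson_norm x + tsirelson_norm y.
Proof.
apply: ge_sup; first exact: range_nonempty.
move=> _ [n _ <-]; apply: le_trans (tnD n x y) _.
by apply: lerD; exact: tsirelson_norm_ge.
Qed.

Let sup_norm_le_tsirelson x i : `|x i| <= tsirelson_norm x.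
Proof.
apply: le_trans (tsirelson_norm_ge 0 x).
by have [C xC] := c00_bounded x; exact: sup_norm_ub xC.
Qed.

Let tsirelson_normZ a x : tsirelson_norm (a *: x) = `|a| * tsirelson_norm x.
Proof.
have le b y : tsirelson_norm (b *: y) <= `|b| * tsirelson_norm y.
  apply: ge_sup; first exact: range_nonempty.
move=> _ [n _ <-]; apply: le_trans (tnZ_le n b y) _.
  by rewrite ler_wpM2l// tsirelson_norm_ge.
apply/eqP; rewrite eq_le le/=; have [->|a0] := eqVneq a 0.
  by rewrite normr0 mul0r; apply: le_trans (sup_norm_le_tsirelson _ 0).
rewrite -ler_pdivlMl ?normr_gt0// -normfV.
by apply: le_trans (le _ _); rewrite scalerA mulVf// scale1r.
Qed.

Let tsirelson_norm0_eq0 x : tsirelson_norm x = 0 -> x = 0.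
Proof.
move=> x0; apply/val_inj/funext => i; apply/eqP; rewrite -normr_le0 -x0.
exact: sup_norm_le_tsirelson.
Qed.

HB.instance Definition _ := Lmodule_isNormed.Build R (c00 R)
  tsirelson_normD tsirelson_normZ tsirelson_norm0_eq0.

Lemma c00_normE x : `|x| = tsirelson_norm x. Proof. by []. Qed.

End tsirelson_norm.

(* The completion of a normed module: Cauchy sequences modulo null sequences,
   with norm |[u]| = lim |u n|. *)
Section cauchy_seq.
Context {R : realType} (V : normedModType R).

Definition cauchy_pred : {pred nat -> V} := fun u => `[< cauchy_sequence u >].

Lemma cauchy_submod_closed : submod_closed cauchy_pred.
Proof.
split=> [|a u v /asboolP uc /asboolP vc]; apply/asboolP.
  by move=> e e0; exists 0%N => m n _ _; rewrite subrr normr0 ltW.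
move=> e e0; have a1 : 0 < `|a| + 1 by rewrite ltr_wpDl.
have [|N uN] := uc (e / 2 / (`|a| + 1)); first by rewrite !divr_gt0.
have [|M vM] := vc (e / 2); first by rewrite divr_gt0.
exists (maxn N M) => m n; rewrite !geq_max => /andP[Nm Mm] /andP[Nn Mn].
have -> : (a *: u + v) m - (a *: u + v) n = a *: (u m - u n) + (v m - v n).
  by rewrite scalerBr [LHS]/(a *: u m + v m - (a *: u n + v n)) opprD addrACA.
apply: le_trans (ler_normD _ _) _; rewrite [leRHS]splitr lerD ?vM//.
rewrite normrZ; apply: le_trans (ler_wpM2l (normr_ge0 a) (uN m n Nm Nn)) _.
rewrite mulrCA ler_piMr//; first by rewrite divr_ge0// ltW.
by rewrite ler_pdivrMr// mul1r lerDl.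
Qed.

HB.instance Definition _ :=
  GRing.isSubmodClosed.Build R (nat -> V) cauchy_pred cauchy_submod_closed.

Record cauchy_seq :=
  CauchySeq { cauchy_seq_val :> nat -> V ; _ : cauchy_seq_val \in cauchy_pred }.

HB.instance Definition _ := [isSub for cauchy_seq_val].
HB.instance Definition _ := [Choice of cauchy_seq by <:].
HB.instance Definition _ := [SubChoice_isSubLmodule of cauchy_seq by <:].

Lemma cauchy_seqP (u : cauchy_seq) : cauchy_sequence u.
Proof. by apply/asboolP; case: u. Qed.

Definition null_pred : {pred cauchy_seq} := fun u => `[< u @ \oo --> (0 : V) >].

Lemma null_zmod_closed : zmod_closed null_pred.
Proof.
split=> [|u v /asboolP u0 /asboolP v0]; apply/asboolP; first exact: cvg_cst.
by rewrite -(subr0 0); apply: cvgB.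
Qed.

HB.instance Definition _ :=
  GRing.isZmodClosed.Build cauchy_seq null_pred null_zmod_closed.

Definition completion := Quotient.quot null_pred.

HB.instance Definition _ := GRing.Zmodule.on completion.
HB.instance Definition _ := EqQuotient.on completion.

End cauchy_seq.

Section completion.
Context {R : realType} (V : normedModType R).
Local Notation cV := (completion V).
Implicit Types (x y : cV) (u v : cauchy_seq V).

Let eqP_completion u v :
  \pi_cV u = \pi_cV v <-> (fun n => u n - v n) @ \oo --> (0 : V).
Proof.
have e : (u - v \in null_pred (V := V)) = (\pi_cV u == \pi_cV v).
  exact: Quotient.idealrBE.
split=> [/eqP|uv]; first by rewrite -e => /asboolP.
by apply/eqP; rewrite -e; apply/asboolP.
Qed.

Let piD u v : \pi_cV (u + v) = \pi_cV u + \pi_cV v.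
Proof. exact: Quotient.pi_add. Qed.

Definition completion_scale (a : R) x : cV := \pi_cV (a *: repr x).

Let pi_repr u : \pi_cV (repr (\pi_cV u)) = \pi_cV u.
Proof. by rewrite reprK. Qed.

Lemma pi_scale a u : completion_scale a (\pi_cV u) = \pi_cV (a *: u).
Proof.
apply/eqP_completion; have /eqP_completion/(cvgZl_tmp (k := a)) := pi_repr u.
rewrite scaler0 => h; rewrite [X in X @ \oo](_ : _ =
  a \*: (fun n => (repr (\pi_cV u) : cauchy_seq V) n - u n))//.
by apply/funext => n; exact/esym/scalerBr.
Qed.

Let scaleA a b x :
  completion_scale a (completion_scale b x) = completion_scale (a * b) x.
Proof.
elim/quotW: x => u.
by rewrite (pi_scale b u) (pi_scale a) (pi_scale (a * b)) scalerA.
Qed.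

Let scale1 : left_id 1 completion_scale.
Proof. by elim/quotW => u; rewrite (pi_scale 1 u) scale1r. Qed.

Let scaleDr : right_distributive completion_scale +%R.
Proof.
move=> a; elim/quotW=> u; elim/quotW=> v.
by rewrite (pi_scale a u) (pi_scale a v) -!piD (pi_scale a) scalerDr.
Qed.

Let scaleDl x : {morph completion_scale^~ x : a b / a + b}.
Proof.
elim/quotW: x => u a b.
by rewrite (pi_scale a u) (pi_scale b u) (pi_scale (a + b) u) -piD scalerDl.
Qed.

HB.instance Definition _ := GRing.Zmodule_isLmodule.Build R (completion V)
  scaleA scale1 scaleDr scaleDl.

Definition completion_norm x : R := limn (fun n => `|(repr x : cauchy_seq V) n|).

Let cvg_norm_seq u : cvgn (fun n => `|u n|).
Proof.
apply/cauchy_cvgP/cauchyP => e e0.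
have [|N uN] := cauchy_seqP u (e := e / 2); first by rewrite divr_gt0.
exists `|u N|; exists N => // n /= Nn; rewrite -ball_normE /=.
apply: le_lt_trans (ler_dist_dist _ _) _.
apply: (@le_lt_trans _ _ (e / 2)); last by rewrite gtr_pMr// invf_lt1// ltr1n.
exact: uN.
Qed.

Lemma completion_normE u : completion_norm (\pi_cV u) = limn (fun n => `|u n|).
Proof.
set v : cauchy_seq V := repr (\pi_cV u).
have /eqP_completion vu := pi_repr u.
apply/eqP; rewrite -subr_eq0 -normr_le0.
rewrite -limB//; [|exact: cvg_norm_seq..].
rewrite -lim_norm; last by apply: is_cvgB; exact: cvg_norm_seq.
have /cvg_norm := vu; rewrite normr0 => vu0; rewrite -(cvg_lim _ vu0)//.
apply: ler_lim; last by apply: nearW => n /=; exact: ler_dist_dist.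
  by apply: is_cvg_norm; apply: is_cvgB; exact: cvg_norm_seq.
by apply/cvg_ex; exists 0.
Qed.

Let completion_normD x y :
  completion_norm (x + y) <= completion_norm x + completion_norm y.
Proof.
elim/quotW: x => u; elim/quotW: y => v.
rewrite -piD !completion_normE -limD//; [|exact: cvg_norm_seq..].
apply: ler_lim; first exact: cvg_norm_seq.
  by apply: is_cvgD; exact: cvg_norm_seq.
by apply: nearW => n; exact: ler_normD.
Qed.

Let completion_normZ a x :
  completion_norm (a *: x) = `|a| * completion_norm x.
Proof.
elim/quotW: x => u; rewrite [a *: _]pi_scale !completion_normE.
have cu := cvg_norm_seq (u := u).
have /(cvgZl_tmp (k := `|a|)) h : `|u n| @[n --> \oo] --> limn (fun n => `|u n|).
  exact: cu.
rewrite -[RHS](cvg_lim _ h)//; congr (limn _); apply/funext => n.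
exact: normrZ.
Qed.

Let completion_norm0_eq0 x : completion_norm x = 0 -> x = 0.
Proof.
elim/quotW: x => u; rewrite completion_normE => u0.
have h : `|u n| @[n --> \oo] --> (0 : R) by rewrite -u0; exact: cvg_norm_seq.
have {}h : u @ \oo --> (0 : V) by exact: norm_cvg0 h.
rewrite -[RHS](scale0r (\pi_cV u)) [RHS]pi_scale scale0r.
apply/eqP_completion; rewrite [X in X @ \oo](_ : _ = (u : nat -> V))//.
by apply/funext => n; exact: subr0.
Qed.

HB.instance Definition _ := Lmodule_isNormed.Build R (completion V)
  completion_normD completion_normZ completion_norm0_eq0.

Let const_cauchy (v : V) : (fun=> v) \in cauchy_pred (V := V).
Proof.
by apply/asboolP => e e0; exists 0%N => m n _ _; rewrite subrr normr0 ltW.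
Qed.

Definition completion_embed (v : V) : cV := \pi_cV (CauchySeq (const_cauchy v)).

Lemma completion_embed_linear : linear completion_embed.
Proof.
move=> a v w; rewrite /completion_embed.
rewrite [_ *: \pi_cV _](pi_scale a (CauchySeq (const_cauchy v))) -piD.
by congr (\pi_cV _); exact: val_inj.
Qed.

Lemma completion_embed_norm (v : V) : `|completion_embed v| = `|v|.
Proof. by rewrite [LHS]completion_normE; apply: cvg_lim; [exact: norm_hausdorff|exact: (cvg_cst `|v|)]. Qed.

Let embed_near u N (v : V) e :
  (forall n, (N <= n)%N -> `|u n - v| <= e) -> `|\pi_cV u - completion_embed v| <= e.
Proof.
move=> uv; set c := CauchySeq (const_cauchy v).
have -> : \pi_cV u - completion_embed v = \pi_cV (u - c).
  by apply/eqP; rewrite subr_eq -piD subrK.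
rewrite [leLHS]completion_normE; apply: limr_le; first exact: cvg_norm_seq.
by exists N => // n /= /uv.
Qed.

Lemma completion_embed_dense x e : 0 < e ->
  exists v : V, `|x - completion_embed v| <= e.
Proof.
elim/quotW: x => u e0; have [N uN] := cauchy_seqP u e0.
by exists (u N); apply: (@embed_near u N) => n Nn; exact: uN.
Qed.

Lemma completion_complete (F : set_system cV) :
  ProperFilter F -> cauchy F -> cvg F.
Proof.
apply: sequentially_complete => X Xc.
have /choice[v Xv] n : exists v : V, `|X n - completion_embed v| <= n.+1%:R^-1.
  by apply: completion_embed_dense; rewrite invr_gt0.
have embedB (w w' : V) : `|w - w'| = `|completion_embed w - completion_embed w'|.
  rewrite -completion_embed_norm -[w - w']addrC -scaleN1r completion_embed_linear.
  by rewrite scaleN1r addrC.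
have vc : v \in cauchy_pred (V := V).
  apply/asboolP => e e0; have e30 : 0 < e / 3 by rewrite divr_gt0.
  have [N HN] := invS_le e30; have [M HM] := Xc _ e30.
  exists (maxn N M) => m n; rewrite !geq_max => /andP[Nm Mm] /andP[Nn Mn].
  have -> : e = e / 3 + e / 3 + e / 3 by lra.
  rewrite embedB; apply: le_trans (ler_distD (X n) _ _) _; apply: lerD.
    apply: le_trans (ler_distD (X m) _ _) _; apply: lerD; last exact: HM.
    by rewrite distrC; apply: le_trans (Xv m) (HN _ Nm).
  exact: le_trans (Xv n) (HN _ Nn).
exists (\pi_cV (CauchySeq vc)) => e e0.
have e20 : 0 < e / 2 by rewrite divr_gt0.
have [N HN] := invS_le e20; have /asboolP/(_ _ e20)[M HM] := vc.
exists (maxn N M) => n; rewrite geq_max => /andP[Nn Mn].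
apply: le_trans (ler_distD (completion_embed (v n)) _ _) _.
rewrite [leRHS]splitr; apply: lerD.
  exact: le_trans (Xv n) (HN _ Nn).
by rewrite distrC; apply: (@embed_near _ M) => m Mm; exact: HM.
Qed.

HB.instance Definition _ := Uniform_isComplete.Build cV completion_complete.

End completion.

Definition tsirelson_space (R : realType) : completeNormedModType R :=
  completion (c00 R).

Definition tsirelson_dual (R : realType) : normedModType R :=
  dual_space (tsirelson_space R).

(* Main.v *)
(* In a nonreflexive X some functional on X^* stays at positive distance from X,
   and Helly's theorem then yields James' bounded sequence (x_n): sums of k terms
   over disjoint consecutive index sets are c k apart. Changing one index moves
   the sum by O(1), so phi composed with such sums gives a Hamming-Lipschitz map
   g from k-tuples of naturals to the dual of Tsirelson's space.
   Iterated weak* limits of g along an ultrafilter write g(n_1, ..., n_k) as a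
   constant plus k increments of norm at most L. The basis of Tsirelson's space is
   shrinking, so for suitable n_i the increments are nearly successive blocks
   beyond coordinate k, whose sum has norm at most 2 L by admissibility. Hence two
   widely separated tuples have images at distance at most 5 L, so kappa <= 5 omega. *)

Require Import Defs.
From mathcomp Require Import all_boot all_order all_algebra.
From mathcomp Require Import all_classical all_reals all_analysis.
From mathcomp Require Import lra ring.

Set Implicit Arguments.
Unset Strict Implicit.
Unset Printing Implicit Defensive.

Import Order.TTheory GRing.Theory Num.Theory.
Import numFieldNormedType.Exports.

Local Open Scope ring_scope.
Local Open Scope classical_set_scope.

(** * Norming functionals *)

Section hahn_banach.
Context {R : realType} {V : lmodType R}.
Implicit Types (p q : V -> R) (x y : V).

Definition sublinear p : Prop :=
  (forall x y, p (x + y) <= p x + p y) /\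
  (forall a x, 0 <= a -> p (a *: x) = a * p x).

Lemma sublinear0 p : sublinear p -> p 0 = 0.
Proof. by move=> [_ pZ]; rewrite -(scale0r 0) pZ// mul0r. Qed.

Lemma sublinear_geN p x : sublinear p -> - p (- x) <= p x.
Proof.
move=> sp; rewrite lerNl -subr_ge0 opprK -(sublinear0 sp) -(addNr x).
by case: sp.
Qed.

Definition slide p y x : R := inf [set p (x + t *: y) - t * p y | t in [set t | 0 <= t]].

Lemma slide_has_lbound p y x : sublinear p ->
  lbound [set p (x + t *: y) - t * p y | t in [set t | 0 <= t]] (- p (- x)).
Proof.
move=> sp _ [t /= t0 <-]; have [pD pZ] := sp.
have := pD (x + t *: y) (- x); rewrite addrAC subrr add0r pZ//; lra.
Qed.

Lemma slide_ub p y x t : sublinear p -> 0 <= t -> slide p y x <= p (x + t *: y) - t * p y.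
Proof.
move=> sp t0; apply: ge_inf; last by exists t.
by exists (- p (- x)); exact: slide_has_lbound.
Qed.

Lemma slide_ge p y x C :
  (forall t, 0 <= t -> C <= p (x + t *: y) - t * p y) -> C <= slide p y x.
Proof.
move=> H; apply: lb_le_inf; last by move=> _ [t t0 <-]; exact: H.
by exists (p (x + 0 *: y) - 0 * p y), 0 => /=.
Qed.

Lemma slide_le p y x : sublinear p -> slide p y x <= p x.
Proof.
move=> sp; rewrite (le_trans (slide_ub y x sp (lexx 0)))//.
by rewrite scale0r addr0 mul0r subr0.
Qed.

Lemma slideN p y : sublinear p -> slide p y (- y) <= - p y.
Proof.
move=> sp; apply: le_trans (slide_ub y (- y) sp ler01) _.
by rewrite scale1r addNr sublinear0// mul1r sub0r.
Qed.

Lemma sublinear_slide p y : sublinear p -> sublinear (slide p y).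
Proof.
move=> sp; have [pD pZ] := sp.
have sD x z : slide p y (x + z) <= slide p y x + slide p y z.
  rewrite -lerBlDr; apply: slide_ge => t t0; rewrite lerBlDl -lerBlDr.
  apply: slide_ge => s s0; rewrite lerBlDr.
  apply: le_trans (slide_ub y (x + z) sp (addr_ge0 t0 s0)) _.
  have := pD (x + t *: y) (z + s *: y).
  have -> : x + t *: y + (z + s *: y) = x + z + (t + s) *: y.
    by rewrite scalerDl addrACA.
  lra.
split=> // a x; rewrite le_eqVlt => /predU1P[<-|a0].
  rewrite scale0r mul0r; apply/eqP; rewrite eq_le; apply/andP; split.
    by rewrite (le_trans (slide_le y 0 sp))// (sublinear0 sp).
  by apply: slide_ge => t t0; rewrite add0r pZ// subrr.
have le b z : 0 < b -> slide p y (b *: z) <= b * slide p y z.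
  move=> b0; rewrite -ler_pdivrMl//; apply: slide_ge => t t0.
  rewrite ler_pdivrMl//.
  apply: le_trans (slide_ub y (b *: z) sp (mulr_ge0 (ltW b0) t0)) _.
  by rewrite -scalerA -scalerDr (pZ _ _ (ltW b0)) -mulrA -mulrBr.
apply/eqP; rewrite eq_le le//= -ler_pdivlMl//.
rewrite -[x in leLHS](scalerK (lt0r_neq0 a0)).
by rewrite le// invr_gt0.
Qed.

(* A minimal sublinear functional is linear, since it coincides with each of
   its slides. *)
Lemma exists_linear_le_sublinear q : sublinear q ->
  exists f : V -> R, linear f /\ forall x, f x <= q x.
Proof.
move=> sq.
pose P p := sublinear p /\ forall x, p x <= q x.
pose T := {p | P p}.
pose le (s t : T) := `[< forall x, sval t x <= sval s x >].
have [t|r s t /asboolP rs /asboolP st|s t /asboolP st /asboolP ts|A Atot|[p [sp pq]] pmin]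
    := @Zorn T le.
- by apply/asboolP.
- by apply/asboolP => x; exact: le_trans (rs x).
- case: s t st ts => [s Ps] [t Pt] /= st ts; apply: eq_exist.
  by apply/funext => x; apply/eqP; rewrite eq_le st ts.
- have [[t0 At0]|A0] := pselect (exists t, A t); last first.
    have Pq : P q by [].
    by exists (exist P q Pq) => s As; case: A0; exists s.
  pose m x := inf [set sval t x | t in A].
  have lb x t : A t -> - q (- x) <= sval t x.
    case: t => [t [st tq]] _ /=; apply: le_trans (sublinear_geN x st).
    by rewrite lerN2.
  have m_ub x t : A t -> m x <= sval t x.
    move=> At; apply: ge_inf; last by exists t.
    by exists (- q (- x)) => _ [s As <-]; exact: lb.
  have m_ge x C : (forall t, A t -> C <= sval t x) -> C <= m x.
    move=> H; apply: lb_le_inf; first by exists (sval t0 x), t0.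
    by move=> _ [s As <-]; exact: H.
  have sm : sublinear m.
    split=> [x y|a x a0].
      rewrite -lerBlDr; apply: (m_ge) => s As; rewrite lerBlDl -lerBlDr.
      apply: (m_ge) => t At; rewrite lerBlDr.
      have sub u : A u -> (forall z, sval u z <= sval s z) ->
          (forall z, sval u z <= sval t z) -> m (x + y) <= sval t y + sval s x.
        move=> Au us ut; apply: le_trans (m_ub _ _ Au) _.
        case: u {Au} us ut => [u [[uD _] _]] /= us ut.
        by apply: le_trans (uD _ _) _; rewrite addrC lerD.
      by have [/asboolP|/asboolP] := Atot _ _ As At => H; [apply: (sub t)|apply: (sub s)].
    move: a0; rewrite le_eqVlt => /predU1P[<-|a0].
      rewrite scale0r mul0r; apply/eqP; rewrite eq_le; apply/andP; split.
        by rewrite (le_trans (m_ub _ _ At0))// sublinear0//; case: (svalP t0).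
      by apply: (m_ge) => t _; rewrite sublinear0//; case: (svalP t).
    apply/eqP; rewrite eq_le; apply/andP; split.
      rewrite -ler_pdivrMl//; apply: (m_ge) => t At; rewrite ler_pdivrMl//.
      by have [[_ tZ] _] := svalP t; rewrite -(tZ _ _ (ltW a0)) m_ub.
    apply: (m_ge) => t At; have [[_ tZ] _] := svalP t.
    by rewrite (tZ _ _ (ltW a0)) ler_pM2l// m_ub.
  have Pm : P m.
    split=> // x; apply: le_trans (m_ub _ _ At0) _.
    by case: t0 {At0} => [t [st tq]] /=.
  by exists (exist P m Pm) => s As; apply/asboolP => x; exact: m_ub.
have Pslide y : P (slide p y).
  split; first exact: sublinear_slide.
  by move=> x; exact: le_trans (slide_le _ _ sp) (pq x).
have slideE y : slide p y = p.
  have le_slide : le (exist P p (conj sp pq)) (exist P _ (Pslide y)).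
    by apply/asboolP => x; exact: slide_le.
  exact: (congr1 (@proj1_sig _ P) (pmin _ le_slide)).
have pN y : p (- y) = - p y.
  apply/eqP; rewrite eq_le -{1}(slideE y) slideN//=.
  by rewrite lerNl sublinear_geN.
have [pD pZ] := sp.
have pDE x y : p (x + y) = p x + p y.
  apply/eqP; rewrite eq_le pD/=.
  have := pD (x + y) (- y); rewrite addrK pN; lra.
exists p; split=> // a x y; rewrite pDE; congr (_ + _).
have [a0|/ltW a0] := leP 0 a; first by rewrite pZ.
by rewrite -[a *: x]opprK -scaleNr pN pZ ?oppr_ge0// mulNr opprK.
Qed.

End hahn_banach.

Lemma dual_norming {R : realType} (V : normedModType R) (x : V) :
  exists f : dual_space V, `|f| <= 1 /\ f x = `|x|.
Proof.
pose N (y : V) : R := `|y|.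
have sN : sublinear N.
  split=> [y z|a y a0]; first exact: ler_normD.
  by rewrite /N normrZ ger0_norm.
have [f [lf fN]] := exists_linear_le_sublinear (sublinear_slide x sN).
have fle y : f y <= `|y| by exact: le_trans (fN y) (slide_le x y sN).
have f0 : f 0 = 0 by have := lf (-1) 0 0; rewrite scaler0 addr0 scaleN1r addNr.
have fNN y : f (- y) = - f y.
  by have := lf (-1) y 0; rewrite !addr0 !scaleN1r f0 addr0.
have fabs y : `|f y| <= `|y|.
  by rewrite ler_norml fle andbT lerNl -fNN -(normrN y).
have fd : f \in @dual_pred R V.
  by apply/dual_predP; split=> //; exists 1 => y; rewrite mul1r.
exists (Dual fd); split.
  by apply: dual_norm_le => y y1; exact: le_trans (fabs y) y1.
apply/eqP; rewrite eq_le fle/=.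
have := le_trans (fN (- x)) (slideN x sN).
by rewrite fNN lerN2.
Qed.

(** * James' sequences *)

(* If the moments c are not nearly attained on the convex set B, then the vector
   from a nearly closest attained moment to c separates c from all of them. *)
Lemma helly {R : realType} {Z : lmodType R} {I : eqType} (B : set Z)
    (g : I -> Z -> R) (c : I -> R) (s : seq I) (M : I -> R) :
  B !=set0 ->
  (forall z w (t : R), B z -> B w -> 0 <= t <= 1 -> B (z + t *: (w - z))) ->
  (forall i, linear (g i)) -> (forall i z, B z -> `|g i z| <= M i) ->
  (forall (a : I -> R) (b : R), (forall z, B z -> \sum_(i <- s) a i * g i z <= b) ->
    \sum_(i <- s) a i * c i <= b) ->
  forall e : R, 0 < e -> exists z, B z /\ forall i, i \in s -> `|g i z - c i| <= e.
Proof.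
move=> [b0 Bb0] Bconv glin gM sep e e0; apply: contrapT => none.
pose q z := \sum_(i <- s) (g i z - c i) ^+ 2.
have q_ge z : B z -> e ^+ 2 <= q z.
  move=> Bz; rewrite leNgt; apply/negP => qz; apply: none; exists z; split=> // i si.
  rewrite leNgt; apply/negP => ei; move: qz; apply/negP; rewrite -leNgt.
  rewrite /q (big_rem i)//= -[leLHS]addr0 lerD ?sumr_ge0//; last first.
    by move=> j _; exact: sqr_ge0.
  by rewrite -[leRHS]real_normK ?num_real// ler_sqr ?nnegrE// ltW.
pose D := inf [set q z | z in B].
have Dlb : lbound [set q z | z in B] (e ^+ 2) by move=> _ [z Bz <-]; exact: q_ge.
have D_le z : B z -> D <= q z.
  by move=> Bz; apply: ge_inf; [exists (e ^+ 2)|exists z].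
have D0 : 0 < D.
  apply: lt_le_trans (_ : e ^+ 2 <= _); first by rewrite exprn_gt0.
  by apply: lb_le_inf => //; exists (q b0), b0.
pose K := \sum_(i <- s) (2 * M i) ^+ 2 + D.
have K0 : 0 < K by rewrite ltr_wpDl// sumr_ge0// => i _; exact: sqr_ge0.
pose t : R := D / (2 * K).
have t0 : 0 < t by rewrite divr_gt0// mulr_gt0.
have t1 : t <= 1.
  rewrite /t ler_pdivrMr ?mulr_gt0// mul1r /K.
  have : 0 <= \sum_(i <- s) (2 * M i) ^+ 2.
    by rewrite sumr_ge0// => i _; exact: sqr_ge0.
  lra.
have [_ [z Bz <-] qz] : exists2 r, [set q z | z in B] r & r < D + t * D / 2.
  apply: inf_adherent; last by split; [exists (q b0), b0|exists (e ^+ 2)].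
  by rewrite divr_gt0// mulr_gt0.
pose a i := c i - g i z.
have key w : B w -> \sum_(i <- s) a i * g i w <= \sum_(i <- s) a i * g i z + D / 2.
  move=> Bw; set S1 := \sum_(i <- s) _; set S2 := \sum_(i <- s) _.
  have t01 : 0 <= t <= 1 by rewrite ltW.
  have := D_le _ (Bconv z w t Bz Bw t01).
  have gE i : g i (z + t *: (w - z)) = g i z + t * (g i w - g i z).
    have gi0 : g i 0 = 0.
      by have := glin i (-1) 0 0; rewrite scaler0 addr0 scaleN1r addNr.
    have -> : z + t *: (w - z) = t *: ((-1) *: z + w) + z.
      by rewrite addrC scaleN1r [- z + w]addrC.
    rewrite (glin i t) (glin i (-1)) scaleN1r addrC [- _ + _]addrC.
    by [].
  have -> : q (z + t *: (w - z)) =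
      q z - 2 * t * (S1 - S2) + t ^+ 2 * \sum_(i <- s) (g i w - g i z) ^+ 2.
    rewrite /q /S1 /S2 -sumrB !mulr_sumr -sumrB -big_split/=.
    apply: eq_bigr => i _; rewrite gE /a; ring.
  set G := \sum_(i <- s) _ => DG.
  have GK : G <= K.
    rewrite /K -[leLHS]addr0; apply: lerD; last exact: ltW.
    apply: ler_sum => i _.
    rewrite -[leLHS]real_normK ?num_real// ler_sqr ?nnegrE//; last first.
      by rewrite mulr_ge0//; exact: le_trans (gM i z Bz).
    apply: le_trans (ler_normB _ _) _.
    by rewrite mulr_natl mulr2n lerD// gM.
  have tG : t ^+ 2 * G <= t * (D / 2).
    rewrite expr2 -mulrA ler_pM2l//; apply: le_trans (ler_wpM2l (ltW t0) GK) _.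
    by rewrite /t invfM mulrA divfK ?gt_eqF.
  rewrite -lerBlDl -(ler_pM2l (mulr_gt0 (ltr0Sn _ 1) t0)); lra.
have := sep a _ key.
have -> : \sum_(i <- s) a i * c i = \sum_(i <- s) a i * g i z + q z.
  by rewrite /q -big_split/=; apply: eq_bigr => i _; rewrite /a; ring.
by have := D_le z Bz; lra.
Qed.

Lemma bidual_eval_subproof {R : realType} (V : normedModType R) (x : V) :
  (fun f : dual_space V => f x) \in @dual_pred R (dual_space V).
Proof.
apply/dual_predP; split=> [a f g //|].
by exists `|x| => f; rewrite mulrC; exact: dual_norm_bound.
Qed.

Definition bidual_eval {R : realType} (V : normedModType R) (x : V) :
  dual_space (dual_space V) := Dual (bidual_eval_subproof x).

Section dual_norm.
Context {R : realType} {V : normedModType R}.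
Implicit Types (f : dual_space V) (x : V).

Lemma dual0 f : f 0 = 0.
Proof. by rewrite -(scale0r 0) dualZ mul0r. Qed.

Lemma dualN f x : f (- x) = - f x.
Proof. by rewrite -scaleN1r dualZ mulN1r. Qed.

Lemma dualB f x y : f (x - y) = f x - f y.
Proof. by rewrite dualD dualN. Qed.

Lemma dual_sum f (I : Type) (s : seq I) (F : I -> V) :
  f (\sum_(i <- s) F i) = \sum_(i <- s) f (F i).
Proof. by elim/big_rec2: _ => [|i a b _ <-]; rewrite ?dual0 ?dualD. Qed.

Lemma dual_linear f : linear f.
Proof. by move=> a x y; rewrite dualD dualZ. Qed.

Lemma ler_norm_dual f x : `|f x| <= `|f| * `|x|.
Proof. exact: dual_norm_bound. Qed.

Lemma ler_dual f x : f x <= `|f| * `|x|.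
Proof. exact: le_trans (ler_norm _) (ler_norm_dual f x). Qed.

Lemma dual_norm_le_signed f C : (forall x, `|x| <= 1 -> f x <= C) -> `|f| <= C.
Proof.
move=> fC; apply: dual_norm_le => x x1; rewrite ler_norml fC// andbT.
by rewrite lerNl -dualN fC// normrN.
Qed.

End dual_norm.

Lemma nonreflexive_dist {R : realType} (X : completeNormedModType R) :
  ~ reflexive_space X ->
  exists (Phi : dual_space (dual_space X)) (d : R),
    0 < d /\ forall x, d <= `|Phi - bidual_eval x|.
Proof.
move=> /existsNP[Phi /forallNP PhiN]; exists Phi; apply: contrapT => near.
have /choice[u uP] (n : nat) : exists x, `|Phi - bidual_eval x| <= n.+1%:R^-1.
  apply: contrapT => /forallNP H; apply: near; exists n.+1%:R^-1.
  by rewrite invr_gt0; split=> // x; have /negP := H x; rewrite -ltNge => /ltW.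
have uB n (f : dual_space X) : `|Phi f - f (u n)| <= n.+1%:R^-1 * `|f|.
  apply: le_trans (ler_norm_dual (Phi - bidual_eval (u n)) f) _.
  exact: ler_wpM2r (normr_ge0 f) _ _ (uP n).
have uuB m n : `|u m - u n| <= m.+1%:R^-1 + n.+1%:R^-1.
  have [f [f1 <-]] := dual_norming (u m - u n).
  have le k : k.+1%:R^-1 * `|f| <= k.+1%:R^-1 :> R by rewrite ler_piMr.
  have := le_trans (uB m f) (le m); have := le_trans (uB n f) (le n).
  rewrite dualB !ler_norml; move: (n.+1%:R^-1) (m.+1%:R^-1) => a b.
  by move=> /andP[_ ?] /andP[? _]; lra.
have uc : cvgn u.
  apply/cauchy_cvgP/cauchyP => e e0.
  have [|N HN] := invS_le (e := e / 2 / 2); first by rewrite !divr_gt0.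
  exists (u N); exists N => // n /= Nn; rewrite -ball_normE /=.
  apply: le_lt_trans (uuB N n) (le_lt_trans (lerD (HN N (leqnn _)) (HN n Nn)) _).
  by rewrite -splitr gtr_pMr// invf_lt1// ltr1n.
apply: (PhiN (limn u)) => f; apply/eqP; rewrite -subr_eq0 -normr_le0.
apply/ler_addgt0Pl => e e0; rewrite addr0.
have f1 : 0 < `|f| + 1 by rewrite ltr_wpDl.
have e20 : 0 < e / 2 / (`|f| + 1) by rewrite !divr_gt0.
have [N HN] := invS_le e20.
have /cvgrPdistC_le/(_ _ e20)[M _ HM] := uc.
pose n := maxn N M.
rewrite -(subrKA (f (u n))) (le_trans (ler_normD _ _))// [leRHS]splitr.
have fe : `|f| * (e / 2 / (`|f| + 1)) <= e / 2.
  rewrite mulrCA ler_piMr//; first exact/ltW/divr_gt0.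
  by rewrite ler_pdivrMr// mul1r lerDl.
apply: lerD.
  apply: le_trans (uB n f) (le_trans _ fe); rewrite mulrC.
  by rewrite ler_wpM2l// HN// leq_maxl.
rewrite -dualB; apply: le_trans (ler_norm_dual _ _) (le_trans _ fe).
apply: (ler_wpM2l (normr_ge0 f)); apply: HM; exact: leq_maxr.
Qed.

Lemma nonreflexive_james {R : realType} (X : completeNormedModType R) :
  ~ reflexive_space X ->
  exists (x : nat -> X) (M c : R), [/\ 0 < c, forall n, `|x n| <= M &
    forall (p : nat) (s1 s2 : seq nat), size s1 = size s2 ->
      (forall i, i \in s1 -> (i < p)%N) -> (forall i, i \in s2 -> (p <= i)%N) ->
      c * (size s1)%:R <= `|\sum_(i <- s2) x i - \sum_(i <- s1) x i| ].
Proof.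
move=> /nonreflexive_dist[Phi [d [d0 dP]]].
pose e := d / 4; have e0 : 0 < e by rewrite divr_gt0.
pose P (s : seq (dual_space X * X)) (p : dual_space X * X) :=
  [/\ `|p.1| <= 1, d - e <= Phi p.1, forall q, q \in s -> `|p.1 q.2| <= e,
      `|p.2| <= `|Phi| & forall q, q \in p :: s -> `|q.1 p.2 - Phi q.1| <= e].
have ball_conv (V : normedModType R) r (z w : V) (t : R) : `|z| <= r -> `|w| <= r ->
    0 <= t <= 1 -> `|z + t *: (w - z)| <= r.
  move=> zr wr /andP[t0 t1]; rewrite scalerBr addrCA -[z in _ + (z - _)]scale1r.
  rewrite -scalerBl; apply: le_trans (ler_normD _ _) _.
  rewrite !normrZ !ger0_norm ?subr_ge0//.
  have := ler_wpM2l t0 wr; have : (1 - t) * `|z| <= (1 - t) * r.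
    by rewrite ler_wpM2l// subr_ge0.
  lra.
have functional (s : seq X) : exists f : dual_space X,
    [/\ `|f| <= 1, d - e <= Phi f & forall x, x \in s -> `|f x| <= e].
  pose g (o : option X) := if o is Some x then bidual_eval x else Phi.
  pose c (o : option X) := if o is Some x then 0 else d.
  have [||||f [/= f1 fP]] := @helly R _ _ [set f : dual_space X | `|f| <= 1]
      g c (None :: map Some s) (fun o => `|g o|) _ _ (fun=> dual_linear _) _ _ e e0.
  - by exists 0; rewrite /= normr0.
  - by move=> z w t /=; exact: ball_conv.
  - move=> i z /= z1; apply: le_trans (ler_norm_dual _ _) _.
    by rewrite ler_piMr.
  - move=> a b H; rewrite big_cons big_map [X in _ + X]big1 => [|x _]; last first.
      by rewrite mulr0.
    have b0 : 0 <= b.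
      have := H 0; rewrite /= normr0 big1 => [|i _]; last by rewrite dual0 mulr0.
      exact.
    rewrite addr0/=; have [aN|aN] := leP (a None) 0.
      by apply: le_trans b0; rewrite mulr_le0_ge0// ltW.
    rewrite mulrC -ler_pdivlMr//.
    pose x := \sum_(x <- s) ((a None)^-1 * a (Some x)) *: x.
    apply: le_trans (dP (- x)) _; apply: dual_norm_le_signed => f f1.
    rewrite [_ f]/(Phi f - f (- x)) dualN opprK ler_pdivlMr// mulrC.
    apply: le_trans (H f f1); rewrite big_cons big_map mulrDr lerD2l.
    rewrite /x dual_sum mulr_sumr ler_sum// => y _.
    by rewrite dualZ !mulrA divff ?gt_eqF// mul1r.
  exists f; split=> // [|x xs].
    have := fP None (mem_head _ _); rewrite ler_norml /= => /andP[+ _]; lra.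
  have := fP (Some x); rewrite /= subr0; apply.
  by rewrite in_cons /= map_f.
have vector (s : seq (dual_space X)) : exists x : X,
    `|x| <= `|Phi| /\ forall f, f \in s -> `|f x - Phi f| <= e.
  have [||||x [/= x1 xP]] := @helly R X _ [set x : X | `|x| <= `|Phi| ]
      (@dual_val R X) Phi s (fun f => `|f| * `|Phi|) _ _ (@dual_linear _ _) _ _ e e0.
  - by exists 0; rewrite /= normr0.
  - by move=> z w t /=; exact: ball_conv.
  - move=> f x /= x1; apply: le_trans (ler_norm_dual _ _) _.
    by rewrite ler_wpM2l.
  - move=> a b H; pose f := \sum_(i <- s) a i *: i.
    have -> : \sum_(i <- s) a i * Phi i = Phi f.
      by rewrite dual_sum; apply: eq_bigr => i _; rewrite dualZ.
    have fE x : \sum_(i <- s) a i * i x = f x.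
      rewrite -[f x]/(bidual_eval x f) dual_sum; apply: eq_bigr => i _.
      by rewrite dualZ.
    have b0 : 0 <= b by have := H 0; rewrite /= normr0 fE dual0; exact.
    have [Phi0|Phi0] := eqVneq `|Phi| 0.
      apply: le_trans b0; apply: le_trans (ler_dual _ _) _.
      by rewrite Phi0 mul0r.
    have {}Phi0 : 0 < `|Phi| by rewrite lt_def Phi0/=.
    apply: le_trans (ler_dual _ _) _; rewrite mulrC -ler_pdivlMr//.
    apply: dual_norm_le_signed => x x1; rewrite ler_pdivlMr// mulrC -dualZ -fE.
    by apply: H; rewrite /= normrZ normr_id ler_piMr.
  by exists x.
have /choice[F FP] s : exists p, P s p.
  have [f [f1 fPhi fs]] := functional (map snd s).
  have [x [x1 xs]] := vector (f :: map fst s).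
  exists (f, x); split=> //= [q qs|q].
    by apply: fs; apply: map_f.
  rewrite in_cons => /predU1P[->|qs]; first by apply: xs; rewrite mem_head.
  by apply: xs; rewrite in_cons map_f// orbT.
pose fix hist n := if n is m.+1 then F (hist m) :: hist m else [::].
pose u n := F (hist n).
have hist_mem i n : (i < n)%N -> u i \in hist n.
  elim: n => // n IH; rewrite ltnS leq_eqVlt in_cons => /predU1P[->|/IH ->].
    by rewrite eqxx.
  by rewrite orbT.
exists (fun n => (u n).2), `|Phi|, e; split=> // [n|p s1 s2 s12 s1p s2p].
  by have [] := FP (hist n).
have [f1 fPhi fpast _ _] := FP (hist p).
pose f := (u p).1.
have le1 i : i \in s1 -> f (u i).2 <= e.
  by move=> /s1p ip; apply: le_trans (ler_norm _) _; apply/fpast/hist_mem.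
have le2 i : i \in s2 -> 2 * e <= f (u i).2.
  move=> /s2p pi; have [_ _ _ _ H] := FP (hist i).
  have : u p \in u i :: hist i.
    move: pi; rewrite leq_eqVlt in_cons => /predU1P[->|/hist_mem ->].
      by rewrite eqxx.
    by rewrite orbT.
  move=> /H; rewrite ler_norml => /andP[+ _]; move: fPhi.
  rewrite -/(u p) -/(u i) -/f /e; lra.
apply: le_trans (_ : f (\sum_(i <- s2) (u i).2 - \sum_(i <- s1) (u i).2) <= _); last first.
  by apply: le_trans (ler_dual _ _) _; rewrite ler_piMl.
rewrite dualB !dual_sum.
have sum_const (s : seq nat) (a : R) : \sum_(i <- s) a = a * (size s)%:R.
  by rewrite big_const_seq count_predT iter_addr_0 mulr_natr.
have S1 : \sum_(i <- s1) f (u i).2 <= e * (size s1)%:R.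
  rewrite -sum_const big_seq [leRHS]big_seq.
  by apply: ler_sum => i; exact: le1.
have S2 : 2 * e * (size s1)%:R <= \sum_(i <- s2) f (u i).2.
  rewrite s12 -sum_const big_seq [leRHS]big_seq.
  by apply: ler_sum => i; exact: le2.
lra.
Qed.

(** * The norm of Tsirelson's space *)

Section tsirelson_norm.
Context {R : realType}.
Implicit Types (x y : c00 R) (I : interval nat).

Local Notation tn := (@tsirelson_norm_ R).

Lemma c00P x y : (forall i, x i = y i) -> x = y.
Proof. by move=> xy; apply/val_inj/funext. Qed.

Lemma c00D x y i : (x + y) i = x i + y i. Proof. by []. Qed.

Lemma c00Z (a : R) x i : (a *: x) i = a * x i. Proof. by []. Qed.

Lemma c00_sum (T : Type) (s : seq T) (F : T -> c00 R) i :
  (\sum_(j <- s) F j) i = \sum_(j <- s) F j i.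
Proof. by elim/big_rec2: _ => // j a b _ <-. Qed.

Lemma c00_projE I x i : c00_proj I x i = if i.+1 \in I then x i else 0.
Proof. by []. Qed.

Lemma c00_projD I x y : c00_proj I (x + y) = c00_proj I x + c00_proj I y.
Proof. by apply: c00P => i; rewrite c00D !c00_projE; case: ifP; rewrite ?addr0. Qed.

Lemma c00_projZ I (a : R) x : c00_proj I (a *: x) = a *: c00_proj I x.
Proof. by apply: c00P => i; rewrite c00Z !c00_projE; case: ifP; rewrite ?mulr0. Qed.

Lemma c00_proj_comm I J x : c00_proj I (c00_proj J x) = c00_proj J (c00_proj I x).
Proof. by apply: c00P => i; rewrite !c00_projE; case: ifP; case: ifP. Qed.

Lemma tsirelson_norm_0_ub x i : `|x i| <= tn 0 x.
Proof.
have [N xN] := c00_finite_support x.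
apply: (@sup_norm_ub _ _ (\sum_(j < N) `|x j|)) => j.
have [jN|/xN ->] := ltnP j N; last by rewrite normr0 sumr_ge0.
by rewrite (bigD1 (Ordinal jN))//= lerDl sumr_ge0.
Qed.

Lemma c00_norm_ub x i : `|x i| <= `|x|.
Proof. exact: le_trans (tsirelson_norm_0_ub x i) (tsirelson_norm_ge 0 x). Qed.

Lemma tsirelson_norm_sum_le n x m (I : 'I_m -> interval nat) : admissible I ->
  2^-1 * \sum_(k < m) tn n (c00_proj (I k) x) <= tn n.+1 x.
Proof.
move=> aI /=; rewrite le_max; apply/orP; right; apply: ub_le_sup.
  exact: tsirelson_norm_sums_has_ubound.
by exists m, I.
Qed.

Lemma tsirelson_norm_succ_le n x C : tn n x <= C ->
  (forall m (I : 'I_m -> interval nat), admissible I ->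
    2^-1 * \sum_(k < m) tn n (c00_proj (I k) x) <= C) -> tn n.+1 x <= C.
Proof.
move=> xC H; rewrite /= ge_max xC/=; apply: ge_sup.
  exists 0, 0%N, (fun=> `]-oo, +oo[%R); split; last by rewrite big_ord0 mulr0.
  by split=> [[]|[]|[]].
by move=> _ [m [I [aI ->]]]; exact: H.
Qed.

Lemma c00_norm_cvg x : tn n x @[n --> \oo] --> `|x|.
Proof.
apply: nondecreasing_cvgn; last exact: tsirelson_norm_has_ubound.
by apply/nondecreasing_seqP => n; rewrite /= le_max lexx.
Qed.

Lemma c00_norm_ge x m (I : 'I_m -> interval nat) : admissible I ->
  2^-1 * \sum_(k < m) `|c00_proj (I k) x| <= `|x|.
Proof.
move=> aI.
have h : 2^-1 * \sum_(k < m) tn n (c00_proj (I k) x) @[n --> \oo] -->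
    2^-1 * \sum_(k < m) `|c00_proj (I k) x|.
  apply: cvgM; first exact: cvg_cst.
  by apply: cvg_big => [|k _]; [exact: add_continuous|exact: c00_norm_cvg].
rewrite -(cvg_lim _ h)//; apply: limr_le; first by apply/cvg_ex; eexists; exact: h.
apply: nearW => n; apply: le_trans (tsirelson_norm_sum_le n x aI) _.
exact: tsirelson_norm_ge.
Qed.

Lemma c00_norm_le x C : (forall i, `|x i| <= C) ->
  (forall m (I : 'I_m -> interval nat), admissible I ->
    2^-1 * \sum_(k < m) `|c00_proj (I k) x| <= C) -> `|x| <= C.
Proof.
move=> xC H; apply: ge_sup; first by exists (tn 0 x), 0%N.
move=> _ [n _ <-]; elim: n => [|n IH]; first exact: sup_norm_le.
apply: tsirelson_norm_succ_le => // m I aI; apply: le_trans (H m I aI).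
by rewrite ler_wpM2l// ler_sum// => k _; exact: tsirelson_norm_ge.
Qed.

Lemma c00_norm_proj I x : `|c00_proj I x| <= `|x|.
Proof.
suff tnP n : tn n (c00_proj I x) <= tn n x.
  apply: ge_sup; first by exists (tn 0 (c00_proj I x)), 0%N.
  by move=> _ [n _ <-]; apply: le_trans (tnP n) (tsirelson_norm_ge n x).
elim: n x => [|n IH] x.
  apply: sup_norm_le => i; rewrite c00_projE; case: ifP => _.
    exact: tsirelson_norm_0_ub.
  by rewrite normr0; apply: le_trans (tsirelson_norm_0_ub x 0).
apply: tsirelson_norm_succ_le.
  by apply: le_trans (IH x) _; rewrite /= le_max lexx.
move=> m J aJ; apply: le_trans (tsirelson_norm_sum_le n x aJ).
by rewrite ler_wpM2l// ler_sum// => k _; rewrite c00_proj_comm.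
Qed.

Lemma c00_proj_eq0 I x : (forall i, i.+1 \in I -> x i = 0) -> c00_proj I x = 0.
Proof. by move=> H; apply: c00P => i; rewrite c00_projE; case: ifP => // /H. Qed.

End tsirelson_norm.

Lemma itv_nat_convex (I : interval nat) (i j k : nat) :
  i \in I -> k \in I -> (i <= j <= k)%N -> j \in I.
Proof.
case: I => l r; rewrite !itv_boundlr => /andP[li _] /andP[_ kr] /andP[ij jk].
by rewrite (le_trans li) ?bnd_simp//= (le_trans _ kr) ?bnd_simp.
Qed.

Lemma sum_indic_unique_le1 {R : realType} (T : finType) (P : T -> Prop) :
  (forall i j, P i -> P j -> i = j) -> \sum_(i : T) (`[< P i >]%:R : R) <= 1.
Proof.
move=> uP; have [[i0 Pi0]|nP] := pselect (exists i, P i).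
  rewrite (bigD1 i0)//= big1 ?addr0 => [|i i0i]; first by rewrite lern1 leq_b1.
  by case: asboolP => // Pi; move: i0i; rewrite (uP _ _ Pi Pi0) eqxx.
by rewrite big1// => i _; case: asboolP => // Pi; case: nP; exists i.
Qed.

Lemma sumr_le1_card {R : realType} n (F : 'I_n -> R) :
  (forall i, F i <= 1) -> \sum_(i < n) F i <= n%:R.
Proof. by move=> F1; rewrite -[n in leRHS]card_ord -sumr_const ler_sum. Qed.

(* A family of fewer than p 1 intervals cuts each y j into pieces only if one of
   its endpoints falls in the j-th block, so the average behaves like a single
   vector of l1-norm one. *)
Lemma tsirelson_norm_average {R : realType} (p : nat -> nat) (y : nat -> c00 R) (r : nat) :
  (0 < r)%N -> (forall j, (p j < p j.+1)%N) ->
  (forall j i, y j i != 0 -> (p j < i.+1 <= p j.+1)%N) ->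
  (forall j, `|y j| <= 1) ->
  `|y 0%N + r%:R^-1 *: \sum_(j < r) y j.+1| <= 3 / 2 + (p 1%N)%:R / r%:R.
Proof.
move=> r0 pS yp y1.
have pmono : {homo p : i j / (i <= j)%N}.
  by apply: homo_leq leqnn leq_trans _ => i; exact: ltnW.
have rR : 0 < r%:R :> R by rewrite ltr0n.
set z := _ *: _.
have z1 : `|z| <= 1.
  rewrite normrZ ger0_norm ?invr_ge0//; rewrite ler_pdivrMl// mulr1.
  apply: le_trans (ler_norm_sum _ _ _) _.
  by apply: sumr_le1_card => j; exact: y1.
have pr0 : 0 <= (p 1%N)%:R / r%:R :> R by rewrite divr_ge0.
have y0E i : (p 1 < i.+1)%N -> y 0%N i = 0.
  move=> pi; apply/eqP; apply: contraTT pi => /yp/andP[_]; by rewrite -leqNgt.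
have zE i : (i.+1 <= p 1)%N -> z i = 0.
  move=> ip; rewrite c00Z c00_sum big1 ?mulr0// => j _; apply/eqP.
  apply: contraTT ip => /yp/andP[+ _]; rewrite -ltnNge; apply: leq_ltn_trans.
  exact: pmono.
apply: c00_norm_le => [i|m I [Ine Idisj Imin]].
  apply: (@le_trans _ _ 1); last lra.
  rewrite c00D; have [ip|pi] := leqP i.+1 (p 1).
    by rewrite zE// addr0; apply: le_trans (c00_norm_ub _ _) (y1 0%N).
  by rewrite y0E// add0r; apply: le_trans (c00_norm_ub _ _) z1.
have adm : admissible I by [].
have [pm|mp] := leqP (p 1) m.
  apply: (@le_trans _ _ 1); last lra.
  apply: le_trans z1; apply: le_trans (c00_norm_ge z adm).
  rewrite ler_wpM2l// ler_sum// => k _; rewrite c00_projD.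
  rewrite (c00_proj_eq0 (x := y 0%N)) ?add0r// => i iI; apply: y0E.
  by apply: leq_ltn_trans pm _; exact: Imin iI.
pose B j (i : nat) := (p j.+1 < i <= p j.+2)%N.
pose inside j k := forall i, B j i -> i \in I k.
pose leftcut j k := exists u v, [/\ (v < u)%N, B j u, B j v, u \in I k & v \notin I k].
pose rightcut j k := exists u v, [/\ (u < v)%N, B j u, B j v, u \in I k & v \notin I k].
pose ind (P : Prop) : R := `[< P >]%:R.
have ind_ge0 P : 0 <= ind P by exact: ler0n.
have indT (P : Prop) : P -> ind P = 1 by move=> /asboolT; rewrite /ind => ->.
have Bjl i j l : (j < l)%N -> forall v, B j i -> B l v -> (i < v)%N.
  move=> jl v /andP[_ ij] /andP[lv _]; apply: leq_ltn_trans ij (leq_ltn_trans _ lv).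
  exact: pmono.
have piece j k : `|c00_proj (I k) (y j.+1)| <=
    ind (inside j k) + ind (leftcut j k) + ind (rightcut j k).
  have le1 : `|c00_proj (I k) (y j.+1)| <= 1.
    exact: le_trans (c00_norm_proj _ _) (y1 _).
  have := ind_ge0 (inside j k); have := ind_ge0 (leftcut j k).
  have := ind_ge0 (rightcut j k).
  have [/indT|/existsNP[v /not_implyP[Bv /negP vI]]] := pselect (inside j k); first lra.
  have [[u [Bu uI]]|nu] := pselect (exists u, B j u /\ u \in I k).
    have [uv|vu|uv] := ltngtP u v.
    - have /indT : rightcut j k by exists u, v.
      lra.
    - have /indT : leftcut j k by exists u, v.
      lra.
    - by move: vI; rewrite -uv uI.
  rewrite (c00_proj_eq0 (x := y j.+1)) ?normr0; first lra.
  move=> i iI; apply/eqP/negPn/negP => /yp Bi; apply: nu; exists i.+1.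
  by split.
have insum j : \sum_(k < m) ind (inside j k) <= 1.
  apply: sum_indic_unique_le1 => k l kin lin; apply/eqP; apply: contrapT => /negP kl.
  have Bp : B j (p j.+2) by rewrite /B pS leqnn.
  by apply: (Idisj _ _ (p j.+2) kl); split; [exact: kin|exact: lin].
have leftsum k : \sum_(j < r) ind (leftcut j k) <= 1.
  apply: sum_indic_unique_le1 => i j.
  move=> [u [v [vu Bu Bv uI vI]]] [u' [v' [vu' Bu' Bv' uI' vI']]]; apply/val_inj.
  have [ij|ji|//] := ltngtP (val i) (val j).
    move: vI'; rewrite (itv_nat_convex uI uI')// (ltnW vu') andbT.
    by rewrite ltnW// (Bjl _ _ _ ij).
  move: vI; rewrite (itv_nat_convex uI' uI)// (ltnW vu) andbT.
  by rewrite ltnW// (Bjl _ _ _ ji).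
have rightsum k : \sum_(j < r) ind (rightcut j k) <= 1.
  apply: sum_indic_unique_le1 => i j.
  move=> [u [v [vu Bu Bv uI vI]]] [u' [v' [vu' Bu' Bv' uI' vI']]]; apply/val_inj.
  have [ij|ji|//] := ltngtP (val i) (val j).
    move: vI; rewrite (itv_nat_convex uI uI')// (ltnW vu)/=.
    by rewrite ltnW// (Bjl _ _ _ ij).
  move: vI'; rewrite (itv_nat_convex uI' uI)// (ltnW vu')/=.
  by rewrite ltnW// (Bjl _ _ _ ji).
have zsum : \sum_(k < m) `|c00_proj (I k) z| <= 1 + 2 * (m%:R / r%:R).
  apply: (@le_trans _ _ (r%:R^-1 * \sum_(j < r) \sum_(k < m)
     (ind (inside j k) + ind (leftcut j k) + ind (rightcut j k)))).
    rewrite exchange_big mulr_sumr ler_sum// => k _.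
    rewrite c00_projZ normrZ ger0_norm ?invr_ge0// ler_wpM2l ?invr_ge0//.
    have -> : c00_proj (I k) (\sum_(j < r) y j.+1) = \sum_(j < r) c00_proj (I k) (y j.+1).
      elim/big_rec2: _ => [|j a b _ <-]; last exact: c00_projD.
      by rewrite c00_proj_eq0.
    by apply: le_trans (ler_norm_sum _ _ _) _; apply: ler_sum => j _; exact: piece.
  rewrite ler_pdivrMl// mulrDr mulr1 mulrCA (mulrCA r%:R) divff ?gt_eqF// mulr1.
  under eq_bigr do rewrite !big_split/=.
  rewrite !big_split/=.
  have -> : 2 * m%:R = m%:R + m%:R :> R by rewrite mulr_natl mulr2n.
  rewrite -addrA; apply: lerD; last apply: lerD.
  - by apply: sumr_le1_card => j; exact: insum.
  - by rewrite exchange_big; apply: sumr_le1_card => k; exact: leftsum.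
  - by rewrite exchange_big; apply: sumr_le1_card => k; exact: rightsum.
have mp' : m%:R / r%:R <= (p 1%N)%:R / r%:R :> R.
  by rewrite ler_pM2r ?invr_gt0// ler_nat ltnW.
have ysum := le_trans (c00_norm_ge (y 0%N) adm) (y1 0%N).
have tri : \sum_(k < m) `|c00_proj (I k) (y 0%N + z)| <=
    \sum_(k < m) `|c00_proj (I k) (y 0%N)| + \sum_(k < m) `|c00_proj (I k) z|.
  by rewrite -big_split ler_sum// => k _; rewrite c00_projD ler_normD.
rewrite ler_pdivrMl// in ysum; rewrite ler_pdivrMl//.
lra.
Qed.

(* Suppose the norms of f on tails decrease to d > 0. Blocks almost attaining d
   give f (y 0 + average) close to 2 d, while the norm of this vector is at most
   slightly more than 3 / 2. *)
Lemma tsirelson_shrinking {R : realType} (f : dual_space (c00 R)) (e : R) : 0 < e ->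
  exists a : nat, forall x : c00 R, (forall i, (i < a)%N -> x i = 0) ->
    `|f x| <= e * `|x|.
Proof.
move=> e0; apply: contrapT => /forallNP fe.
pose S := [set C | exists a : nat, forall x : c00 R,
  (forall i, (i < a)%N -> x i = 0) -> `|f x| <= C * `|x|].
have Slb : lbound S e.
  move=> C [a aC]; rewrite leNgt; apply/negP => Ce; apply: (fe a) => x xa.
  by apply: le_trans (aC x xa) _; rewrite ler_wpM2r// ltW.
have S0 : S !=set0 by exists `|f|, 0%N => x _; exact: ler_norm_dual.
pose d := inf S.
have d0 : 0 < d by apply: lt_le_trans e0 _; exact: lb_le_inf.
have [C [n0 n0C] Cd] : exists2 C, S C & C < d + d / 20.
  by apply: inf_adherent; [rewrite divr_gt0|split=> //; exists e].
have block (n : nat) : exists yq : c00 R * nat,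
    [/\ (n < yq.2)%N, forall i, yq.1 i != 0 -> (n < i.+1 <= yq.2)%N, `|yq.1| <= 1 &
      d - d / 20 <= f yq.1].
  have nS : ~ S (d - d / 20).
    move=> Sd; suff : d <= d - d / 20 by lra.
    by apply: ge_inf => //; exists e.
  have [x /not_implyP[xn /negP]] : exists x : c00 R,
      ~ ((forall i, (i < n)%N -> x i = 0) -> `|f x| <= (d - d / 20) * `|x|).
    by apply: contrapT => /forallNP H; apply: nS; exists n => x xn; exact: contrapT (H x) xn.
  rewrite -ltNge => fx.
  have x0 : 0 < `|x|.
    rewrite normr_gt0; apply/eqP => x0; move: fx.
    by rewrite x0 dual0 !normr0 mulr0 ltxx.
  have [N xN] := c00_finite_support x.
  pose v := (Num.sg (f x) * `|x|^-1) *: x.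
  have vx i : v i != 0 -> x i != 0.
    by rewrite /v c00Z mulf_eq0 negb_or => /andP[].
  exists (v, maxn n.+1 N); split=> /=.
  - by rewrite leq_max leqnn.
  - move=> i /vx xi; rewrite ltnS.
    have -> /= : (n <= i)%N by rewrite leqNgt; apply: contra_neqN xi => /xn.
    by rewrite leq_max orbC; case: ltnP => // /xN xi0; rewrite xi0 eqxx in xi.
  - rewrite /v normrZ normrM normr_sg normfV normr_id -mulrA (mulVf (lt0r_neq0 x0)) mulr1.
    by case: (_ != 0).
  - rewrite /v dualZ mulrAC -normrEsg ler_pdivlMr//; exact: ltW.
have [F FP] := choice block.
pose p j := iter j (fun n => (F n).2) n0; pose y j := (F (p j)).1.
have pS j : (p j < p j.+1)%N by have [] := FP (p j).
have pge j : (n0 <= p j)%N by elim: j => // j IH; rewrite (leq_trans IH)// ltnW.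
have yp j i : y j i != 0 -> (p j < i.+1 <= p j.+1)%N by have [_ + _ _] := FP (p j); apply.
have y1 j : `|y j| <= 1 by have [] := FP (p j).
have fy j : d - d / 20 <= f (y j) by have [] := FP (p j).
pose r := (10 * p 1).+1.
have := tsirelson_norm_average (ltn0Sn _ : (0 < r)%N) pS yp y1.
set z := _ + _ => zle.
have pr : (p 1)%:R / r%:R <= 1 / 10 :> R.
  have -> : r%:R = 10 * (p 1%N)%:R + 1 :> R by rewrite /r -[_.+1]addn1 natrD natrM.
  by rewrite ler_pdivrMr ?ltr_wpDl ?mulr_ge0//; lra.
have fz : 2 * (d - d / 20) <= f z.
  rewrite dualD dualZ dual_sum mulr_natl mulr2n lerD// ler_pdivlMl ?ltr0n//.
  rewrite mulr_natl -[r in leLHS]card_ord -sumr_const ler_sum// => j _; exact: fy.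
have zn0 i : (i < n0)%N -> z i = 0.
  have yi j : (i < n0)%N -> y j i = 0.
    move=> i0; apply/eqP; apply: contraTT i0 => /yp/andP[+ _].
    by rewrite ltnS -leqNgt; exact: leq_trans.
  by move=> i0; rewrite c00D c00Z c00_sum yi// big1 ?mulr0 ?addr0// => j _; rewrite yi.
have := le_trans fz (le_trans (ler_norm _) (n0C z zn0)).
have : C * `|z| <= (d + d / 20) * (3 / 2 + 1 / 10).
  apply: le_trans (ler_wpM2r (normr_ge0 z) (ltW Cd)) _.
  by rewrite ler_wpM2l//; [lra|exact: le_trans zle (lerD _ pr)].
lra.
Qed.

(** * Concentration in the dual of Tsirelson's space *)

Section ultrafilter_limit.
Context {R : realType} (U : set_system nat) {UU : UltraFilter U}.

Lemma ultra_cvg (u : nat -> R) (M : R) : (forall n, `|u n| <= M) ->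
  cvg (u n @[n --> U]).
Proof.
move=> uM; have [|l [_ ul]] := @segment_compact R (- M) M (u n @[n --> U]) _.
  apply: (@filterS _ U _ setT) => [n _|]; last exact: filterT.
  by rewrite /= in_itv/= -ler_norml.
apply/cvg_ex; exists l => A lA; rewrite /= /fmap/=.
have [//|UA] := in_ultra_setVsetC (u @^-1` A) UU.
by have [z [/= nAz Az]] := ul (~` A) A UA lA.
Qed.

Context {V : normedModType R}.
Implicit Types (h : nat -> dual_space V) (l : dual_space V).

Lemma ultra_le (u : nat -> R) (l C : R) : u n @[n --> U] --> l ->
  (forall n, u n <= C) -> l <= C.
Proof.
move=> ul uC; rewrite -(cvg_lim _ ul)//; apply: limr_le.
  by apply/cvg_ex; exists l.
by apply: nearW.
Qed.

(* Equal to 0 when h has no pointwise limit along U; a bounded h always has one. *)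
Definition weak_lim h : dual_space V :=
  xget (0 : dual_space V) [set l : dual_space V | forall x, h n x @[n --> U] --> l x].

Lemma weak_lim_cvg h (B : R) : (forall n, `|h n| <= B) ->
  forall x, h n x @[n --> U] --> weak_lim h x.
Proof.
move=> hB; have hx x : cvg (h n x @[n --> U]).
  apply: (@ultra_cvg _ (B * `|x|)) => n; apply: le_trans (ler_norm_dual _ _) _.
  by rewrite ler_wpM2r.
pose l x := lim (h n x @[n --> U]).
have ld : l \in @dual_pred R V.
  apply/dual_predP; split=> [a x y|].
    apply: cvg_lim => //.
    under eq_fun do rewrite dual_linear.
    by apply: cvgD; [apply: cvgM; [exact: cvg_cst|exact: hx]|exact: hx].
  exists B => x; apply: (@ultra_le (fun n => `|h n x|)).
    by apply: cvg_norm; exact: hx.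
  move=> n; apply: le_trans (ler_norm_dual _ _) _; by rewrite ler_wpM2r.
rewrite /weak_lim; case: xgetP => [l' _ //|/(_ (Dual ld))[]]; exact: hx.
Qed.

Lemma weak_lim_dist h h' (B L : R) : (forall n, `|h n| <= B) ->
  (forall n, `|h' n| <= B) -> (forall n, `|h n - h' n| <= L) ->
  `|weak_lim h - weak_lim h'| <= L.
Proof.
move=> hB hB' hh; apply: dual_norm_le_signed => x x1.
apply: (@ultra_le (fun n => h n x - h' n x)).
  rewrite [_ x]/(weak_lim h x - weak_lim h' x).
  by apply: cvgB; [exact: (weak_lim_cvg hB)|exact: (weak_lim_cvg hB')].
move=> n; apply: le_trans (ler_dual (h n - h' n) x) _.
by apply: le_trans (hh n); rewrite ler_piMr.
Qed.

Lemma weak_lim_cst l : weak_lim (fun=> l) = l.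
Proof.
apply/val_inj/funext => x.
have lx : l x @[n --> U] --> weak_lim (fun=> l) x.
  exact: (@weak_lim_cvg (fun=> l) `|l|).
by rewrite -[LHS](cvg_lim _ lx)//; apply: cvg_lim => //; exact: cvg_cst.
Qed.

Lemma weak_lim_le h (B : R) : (forall n, `|h n| <= B) -> `|weak_lim h| <= B.
Proof.
move=> hB; have B0 : 0 <= B by apply: le_trans (hB 0%N).
rewrite -[weak_lim h]subr0 -[X in _ - X](weak_lim_cst 0).
by apply: (weak_lim_dist hB) => n; rewrite ?normr0 ?subr0.
Qed.

Fixpoint iter_lim d (g : seq nat -> dual_space V) : dual_space V :=
  if d is d'.+1 then weak_lim (fun n => iter_lim d' (fun s => g (n :: s)))
  else g [::].

Lemma iter_lim_le d g (B : R) : (forall s, size s = d -> `|g s| <= B) ->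
  `|iter_lim d g| <= B.
Proof.
elim: d g => [|d IH] g gB; first exact: gB.
by apply: weak_lim_le => n; apply: IH => s sd; apply: gB; rewrite /= sd.
Qed.

Lemma iter_lim_dist d g g' (B L : R) : (forall s, size s = d -> `|g s| <= B) ->
  (forall s, size s = d -> `|g' s| <= B) ->
  (forall s, size s = d -> `|g s - g' s| <= L) ->
  `|iter_lim d g - iter_lim d g'| <= L.
Proof.
elim: d g g' => [|d IH] g g' gB gB' gg; first exact: gg.
apply: (@weak_lim_dist _ _ B) => n.
- by apply: iter_lim_le => s sd; apply: gB; rewrite /= sd.
- by apply: iter_lim_le => s sd; apply: gB'; rewrite /= sd.
- by apply: IH => s sd; [apply: gB|apply: gB'|apply: gg]; rewrite /= sd.
Qed.

End ultrafilter_limit.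

Lemma c00_basis_subproof {R : realType} (i : nat) :
  (fun j => (j == i)%:R : R) \in @c00_pred R.
Proof. by apply/asboolP; exists i.+1 => j; case: ltngtP. Qed.

Definition c00_basis {R : realType} (i : nat) : c00 R := C00 (c00_basis_subproof i).

Lemma c00_split {R : realType} (x : c00 R) (a b : nat) : (a <= b)%N ->
  x = \sum_(i < a) x i *: c00_basis i + c00_proj `]a, b]%O x + c00_proj `]b, +oo[%O x.
Proof.
move=> ab; apply: c00P => i; rewrite !c00D c00_sum !c00_projE !in_itv/= andbT.
rewrite !ltEnat !leEnat/=.
have -> : \sum_(j < a) (x j *: c00_basis j : c00 R) i = if (i < a)%N then x i else 0.
  transitivity (\sum_(j < a) x j * (i == j)%:R); first by [].
  case: ifPn => [ia|ai].
    rewrite (bigD1 (Ordinal ia))//= big1 => [|j]; first by rewrite eqxx mulr1 addr0.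
    by rewrite -val_eqE/= eq_sym => /negPf ->; rewrite mulr0.
  rewrite big1// => j _; case: eqP => [ij|_]; last exact: mulr0.
  by move: ai; rewrite ij ltn_ord.
have [ia|ai] := ltnP i a; have [ib|bi] := ltnP i b; rewrite /= ?addr0 ?add0r//=.
- by rewrite ltnS leqNgt ia /= ltnS leqNgt ib/= !addr0.
- by have := leq_trans ia ab; rewrite ltnNge bi.
- by rewrite ltnS ai/= ltnS leqNgt ib addr0.
- by rewrite ltnS andbF ltnS bi add0r.
Qed.

Section concentration.
Context {R : realType} (U : set_system nat) {UU : UltraFilter U}.
Hypothesis Uoo : \oo `<=` U.
Implicit Types (g : seq nat -> dual_space (c00 R)).

Lemma weak_null_head (h : nat -> dual_space (c00 R)) (B e : R) (a : nat) : 0 < e ->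
  (forall n, `|h n| <= B) ->
  U [set n | forall x : c00 R,
     `|(h n - weak_lim U h) (\sum_(i < a) x i *: c00_basis i)| <= e * `|x|].
Proof.
move=> e0 hB; have : \sum_(i < a) `|(h n - weak_lim U h) (c00_basis i)| @[n --> U] -->
    \sum_(i < a) (0 : R).
  apply: cvg_big => [|i _]; first exact: add_continuous.
  rewrite -[X in _ --> X](normr0 R) -(subrr (weak_lim U h (c00_basis i))).
  apply: cvg_norm; apply: cvgB; last exact: cvg_cst.
  exact: (weak_lim_cvg hB).
rewrite big1// => /cvgr0_norm_le/(_ e e0); apply: filterS => n hn x.
rewrite dual_sum; apply: le_trans (ler_norm_sum _ _ _) _.
apply: le_trans (_ : \sum_(i < a) `|(h n - weak_lim U h) (c00_basis i)| * `|x| <= _).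
  by apply: ler_sum => i _; rewrite dualZ normrM mulrC ler_wpM2l// c00_norm_ub.
by rewrite -mulr_suml ler_wpM2r// (le_trans (ler_norm _)).
Qed.

Lemma iter_lim_block d g (B L : R) (a N : nat) (e : R) : 0 < e ->
  (forall s, size s = d -> `|g s| <= B) ->
  (forall s1 n m s2, `|g (s1 ++ n :: s2) - g (s1 ++ m :: s2)| <= L) ->
  exists (s : seq nat) (b : nat -> nat),
    [/\ size s = d, forall i, i \in s -> (N < i)%N, b 0%N = a,
      forall j, (b j < b j.+1)%N &
      forall x : c00 R, `|g s x - iter_lim U d g x| <=
        L * \sum_(j < d) `|c00_proj `](b j), (b j.+1)]%O x| + d%:R * e * `|x| ].
Proof.
move=> e0; elim: d g a N => [|d IH] g a N gB gL.
  exists [::], (addn a); split=> // [|j|x]; first exact: addn0.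
    by rewrite ltn_add2l.
  by rewrite subrr normr0 big_ord0 mulr0 !mul0r addr0.
have gnB n s : size s = d -> `|g (n :: s)| <= B by move=> sd; apply: gB; rewrite /= sd.
have gnL n s1 i j s2 : `|g (n :: s1 ++ i :: s2) - g (n :: s1 ++ j :: s2)| <= L.
  exact: (gL (n :: s1)).
pose h n := iter_lim U d (fun s => g (n :: s)).
have hB n : `|h n| <= B by apply: iter_lim_le; exact: gnB.
have hL n : `|h n - weak_lim U h| <= L.
  rewrite -(weak_lim_cst (h n)); apply: (weak_lim_dist _ hB) => [//|m].
  apply: (@iter_lim_dist _ _ _ _ _ (fun s => g (n :: s)) (fun s => g (m :: s)) B).
  - exact: gnB.
  - exact: gnB.
  - by move=> s _; exact: (gL [::]).
have e20 : 0 < e / 2 by rewrite divr_gt0.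
have [n [/= nN nhead]] := filter_ex (filterI (Uoo (nbhs_infty_gt N)) (weak_null_head a e20 hB)).
have [a0 a0P] := tsirelson_shrinking (h n - weak_lim U h) e20.
pose a1 := maxn a.+1 a0.
have [s [b [sd sn b0 bS sP]]] := IH _ a1 n (gnB n) (gnL n).
exists (n :: s), (fun j => if j is j'.+1 then b j' else a); split=> //=.
- by rewrite sd.
- by move=> i; rewrite in_cons => /predU1P[->//|/sn]; exact: ltn_trans.
- by case=> [|//]; rewrite b0 leq_maxl.
move=> x; rewrite -(subrKA (h n x)); apply: le_trans (ler_normD _ _) _.
have := sP x; rewrite -/(h n) big_ord_recl/= b0.
under [in X in _ -> X]eq_bigr do rewrite /bump /= add1n.
set S := \sum_(j < d) _; set T := `|c00_proj _ x|.
suff : `|h n x - weak_lim U h x| <= L * T + e * `|x|.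
  by rewrite -natr1; lra.
rewrite -[h n x - _]/((h n - weak_lim U h) x) {1}(c00_split x (_ : a <= a1)%N); last first.
  by rewrite ltnW// leq_maxl.
rewrite !dualD; apply: le_trans (ler_normD _ _) _.
have tail : `|(h n - weak_lim U h) (c00_proj `]a1, +oo[%O x)| <= e / 2 * `|x|.
  apply: le_trans (a0P _ _) _; last by rewrite ler_wpM2l// ?c00_norm_proj// ltW.
  move=> i ia0; rewrite c00_projE in_itv/= andbT ltEnat/= ltnS leqNgt.
  by rewrite (leq_trans ia0) ?leq_maxr.
have mid : `|(h n - weak_lim U h) (c00_proj `]a, a1]%O x)| <= L * T.
  by apply: le_trans (ler_norm_dual _ _) _; rewrite ler_wpM2r.
have := ler_normD ((h n - weak_lim U h) (\sum_(i < a) x i *: c00_basis i))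
  ((h n - weak_lim U h) (c00_proj `]a, a1]%O x)).
have := nhead x; lra.
Qed.

Lemma iter_lim_near d g (B L : R) (N : nat) : 0 < L ->
  (forall s, size s = d -> `|g s| <= B) ->
  (forall s1 n m s2, `|g (s1 ++ n :: s2) - g (s1 ++ m :: s2)| <= L) ->
  exists s : seq nat, [/\ size s = d, forall i, i \in s -> (N < i)%N &
    `|g s - iter_lim U d g| <= 5 / 2 * L].
Proof.
move=> L0 gB gL; pose e := L / 2 / d.+1%:R.
have e0 : 0 < e by rewrite !divr_gt0.
have [s [b [sd sN b0 bS sP]]] := iter_lim_block d N e0 gB gL.
exists s; split=> //; apply: dual_norm_le => x x1.
have bmono : {homo b : i j / (i <= j)%N}.
  by apply: homo_leq leqnn leq_trans _ => i; exact: ltnW.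
have adm : admissible (fun j : 'I_d => `](b j), (b j.+1)]%O).
  split=> [j|j k i|j i].
  - by exists (b j.+1); rewrite in_itv/= ltEnat leEnat/= bS leqnn.
  - rewrite !in_itv/= !ltEnat !leEnat/= => jk [/andP[ji ij] /andP[ki ik]].
    have [jk'|kj|/val_inj jk'] := ltngtP (val j) (val k); last by rewrite jk' eqxx in jk.
    + by have := leq_ltn_trans (leq_trans ij (bmono _ _ jk')) ki; rewrite ltnn.
    + by have := leq_ltn_trans (leq_trans ik (bmono _ _ kj)) ji; rewrite ltnn.
  - rewrite in_itv/= ltEnat/= => /andP[+ _]; apply: leq_ltn_trans.
    by have := bmono 0%N j (leq0n _); rewrite b0.
have := le_trans (c00_norm_ge x adm) x1; rewrite ler_pdivrMl// mulr1 => sum2.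
apply: le_trans (sP x) _.
apply: (@le_trans _ _ (L * 2 + d%:R * e * 1)).
  by apply: lerD; rewrite ler_wpM2l ?mulr_ge0// ltW.
have : d%:R * e <= L / 2.
  rewrite /e mulrCA ler_piMr//; first by rewrite divr_ge0// ltW.
  by rewrite ler_pdivrMr// mul1r ler_nat.
lra.
Qed.

End concentration.

Lemma hamming_bounded {R : realType} (V : normedModType R) (L : R) d
    (g : seq nat -> V) :
  (forall s1 n m s2, `|g (s1 ++ n :: s2) - g (s1 ++ m :: s2)| <= L) ->
  exists B, forall s, size s = d -> `|g s| <= B.
Proof.
elim: d g => [|d IH] g gL; first by exists `|g [::]| => s /size0nil ->.
have [s1 n m s2|B HB] := IH (fun s => g (0%N :: s)); first exact: (gL (0%N :: s1)).
exists (L + B) => -[//|n s] [sd]; rewrite -[g _](subrK (g (0%N :: s))).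
by apply: le_trans (ler_normD _ _) _; rewrite lerD ?HB//; exact: (gL [::]).
Qed.

Lemma tsirelson_concentration {R : realType} (L : R) d
    (g : seq nat -> dual_space (c00 R)) : 0 < L ->
  (forall s1 n m s2, `|g (s1 ++ n :: s2) - g (s1 ++ m :: s2)| <= L) ->
  exists (p : nat) (s1 s2 : seq nat),
    [/\ size s1 = d, size s2 = d, forall i, i \in s1 -> (i < p)%N,
      forall i, i \in s2 -> (p <= i)%N & `|g s2 - g s1| <= 5 * L].
Proof.
move=> L0 gL; have [U [UU Uoo]] := ultraFilterLemma (@eventually_filter).
have [B gB] := hamming_bounded d gL.
have [s1 [s1d _ s1P]] := iter_lim_near Uoo 0 L0 gB gL.
pose p := (\max_(i <- s1) i).+1.
have [s2 [s2d s2p s2P]] := iter_lim_near Uoo p L0 gB gL.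
exists p, s1, s2; split=> // [i si|i /s2p/ltnW//|].
  by rewrite ltnS; exact: leq_bigmax_seq.
rewrite -(subrKA (iter_lim U d g)); apply: le_trans (ler_normD _ _) _.
by rewrite [X in _ + X]distrC; have := lerD s1P s2P; lra.
Qed.

(** * The coarse embeddability ratio *)

Section completion_dual.
Context {R : realType} {V : normedModType R}.
Implicit Types F G : dual_space (completion V).

Lemma dual_restrict_subproof F : F \o @completion_embed R V \in @dual_pred R V.
Proof.
apply/dual_predP; split=> [a x y|]; first by rewrite /= completion_embed_linear dual_linear.
by exists `|F| => x; rewrite -completion_embed_norm; exact: ler_norm_dual.
Qed.

Definition dual_restrict F : dual_space V := Dual (dual_restrict_subproof F).

Lemma dual_restrict_norm F : `|dual_restrict F| = `|F|.
Proof.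
apply/eqP; rewrite eq_le; apply/andP; split.
  apply: dual_norm_le => x x1; apply: le_trans (ler_norm_dual F _) _.
  by rewrite ler_piMr// completion_embed_norm.
apply: dual_norm_le_signed => x x1; apply/ler_addgt0Pl => e e0.
set r := `|dual_restrict F|; pose D := r + `|F| + 1.
have r0 : 0 <= r by exact: normr_ge0.
have D0 : 0 < D by rewrite ltr_wpDl// addr_ge0.
have [v xv] := completion_embed_dense x (divr_gt0 e0 D0).
have v1 : `|v| <= 1 + e / D.
  rewrite -completion_embed_norm -[completion_embed v](subrK x) addrC.
  by apply: le_trans (ler_normD _ _) _; rewrite lerD// distrC.
have h1 : F (x - completion_embed v) <= `|F| * (e / D).
  by apply: le_trans (ler_dual _ _) _; rewrite ler_wpM2l.
have h2 : F (completion_embed v) <= r * (1 + e / D).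
  by apply: le_trans (ler_dual (dual_restrict F) v) _; rewrite ler_wpM2l.
rewrite -[x](subrK (completion_embed v)) dualD.
have : (r + `|F|) * (e / D) <= e.
  rewrite mulrCA ler_piMr//; first exact: ltW.
  by rewrite ler_pdivrMr// mul1r lerDl.
rewrite mulrDl; lra.
Qed.

Lemma dual_restrictB F G : dual_restrict F - dual_restrict G = dual_restrict (F - G).
Proof. exact: val_inj. Qed.

End completion_dual.

Section nonreflexive_sequence_spaces.
Context {R : realType} (U : set_system nat) {UU : UltraFilter U}.
Hypothesis Uoo : \oo `<=` U.

Lemma step_bounded (n : nat) (i : nat) : `|(i < n)%:R : R| <= 1.
Proof. by rewrite normr_nat lern1 leq_b1. Qed.

(* A reflexive space containing the steps would contain their weak limit, which
   has all coordinates equal to 1. *)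
Lemma reflexive_step_limit (X : normedModType R) (s : nat -> X) (coord : nat -> dual_space X) :
  reflexive_space X -> (forall n, `|s n| <= 1) ->
  (forall n i, coord i (s n) = (i < n)%:R) ->
  exists x : X, (forall i, coord i x = 1) /\
    forall f : dual_space X, f (s n) @[n --> U] --> f x.
Proof.
move=> refl s1 cs.
have b1 n : `|bidual_eval (s n)| <= 1.
  by apply: dual_norm_le => f f1; apply: le_trans (ler_norm_dual f (s n)) _; rewrite mulr_ile1.
have [x xP] := refl (weak_lim U (fun n => bidual_eval (s n))).
exists x; have sx (f : dual_space X) : f (s n) @[n --> U] --> f x.
  by rewrite -xP; exact: (weak_lim_cvg b1).
split=> // i; rewrite -(cvg_lim _ (sx (coord i)))//; apply: cvg_lim => //.
apply/cvgrPdist_le => e e0; apply: (filterS _ (Uoo (nbhs_infty_gt i))) => n /= ni.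
by rewrite cs ni subrr normr0 ltW.
Qed.

Lemma c0_coord_subproof (i : nat) : (fun x : c0 R => x i) \in @dual_pred R (c0 R).
Proof.
apply/dual_predP; split=> //; exists 1 => x; rewrite mul1r.
by have [C xC] := c0_bounded x; exact: sup_norm_ub xC.
Qed.

Lemma step_c0_subproof (n : nat) : (fun i => (i < n)%:R : R) \in @c0_pred R.
Proof.
apply/asboolP/cvgrPdist_le => e e0; exists n => // i /= ni.
by rewrite ltnNge ni subrr normr0 ltW.
Qed.

Lemma c0_nonreflexive : ~ reflexive_space (c0 R).
Proof.
move=> /(@reflexive_step_limit _ (fun n => C0 (step_c0_subproof n))
  (fun i => Dual (c0_coord_subproof i)))[n|//|x [x1 _]].
  by apply: sup_norm_le => i; exact: step_bounded.
have /cvgrPdist_le/(_ (1 / 2)) := c0_cvg x.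
rewrite divr_gt0// => /(_ isT)[N _ /(_ N (leqnn _))].
rewrite [c0_val x N](x1 N) sub0r normrN normr1; lra.
Qed.

Lemma linf_coord_subproof (i : nat) : (fun x : linf R => x i) \in @dual_pred R (linf R).
Proof.
apply/dual_predP; split=> //; exists 1 => x; rewrite mul1r; exact: linf_norm_ub.
Qed.

Lemma step_linf_subproof (n : nat) : (fun i => (i < n)%:R : R) \in @linf_pred R.
Proof. by apply/asboolP; exists 1; exact: step_bounded. Qed.

Lemma linf_lim_subproof : (fun x : linf R => lim (x i @[i --> U])) \in @dual_pred R (linf R).
Proof.
have cv (x : linf R) : cvg (x i @[i --> U]) := ultra_cvg (linf_norm_ub x).
apply/dual_predP; split=> [a x y|].
  apply: cvg_lim => //; apply: cvgD; last exact: cv.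
  by apply: cvgM; [exact: cvg_cst|exact: cv].
exists 1 => x; rewrite mul1r; apply: (@ultra_le _ U _ (fun i => `|x i|)).
  by apply: cvg_norm; exact: cv.
exact: linf_norm_ub.
Qed.

Lemma linf_nonreflexive : ~ reflexive_space (linf R).
Proof.
move=> /(@reflexive_step_limit _ (fun n => Linf (step_linf_subproof n))
  (fun i => Dual (linf_coord_subproof i)))[n|//|x [x1 xlim]].
  by apply: sup_norm_le => i; exact: step_bounded.
have := xlim (Dual linf_lim_subproof).
have -> : Dual linf_lim_subproof x = 1.
  apply: cvg_lim => //; rewrite (_ : linf_val x = fun=> 1); first exact: cvg_cst.
  by apply/funext => i; exact: (x1 i).
have -> : (fun n => Dual linf_lim_subproof (Linf (step_linf_subproof n))) = fun=> 0.
  apply/funext => n; apply: cvg_lim => //; apply/cvgrPdist_le => e e0.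
  apply: (filterS _ (Uoo (nbhs_infty_ge n))) => i /= ni.
  by rewrite ltnNge ni subrr normr0 ltW.
move=> l01; have : 0 = 1 :> R.
  by rewrite -(cvg_lim _ l01)//; apply/esym/cvg_lim => //; exact: cvg_cst.
by move/eqP; rewrite eq_sym oner_eq0.
Qed.

End nonreflexive_sequence_spaces.

Local Open Scope ereal_scope.

Lemma kappa_ge0 {R : realType} (M1 M2 : metricType R) (phi : M1 -> M2) : 0 <= kappa phi.
Proof.
apply: (@le_trans _ _ (compression phi 1)); last by apply: ereal_sup_ubound; exists 1%R => /=.
by apply: le_ereal_inf_tmp => _ [p _ <-]; rewrite lee_fin mdist_ge0.
Qed.

Lemma omega_ge0 {R : realType} (M1 M2 : metricType R) (phi : M1 -> M2) (x : M1) :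
  0 <= omega phi.
Proof.
apply: le_ereal_inf_tmp => _ [t t0 <-].
apply: (@le_trans _ _ (mdist (phi x) (phi x))%:E); first by rewrite lee_fin mdist_ge0.
by apply: ereal_sup_ubound; exists (x, x); rewrite //= mdistxx ltW.
Qed.

Lemma separation_ratio_le {R : realType} (M1 M2 : metricType R) (phi : M1 -> M2)
    (x : M1) (C : R) : (0 <= C)%R ->
  (forall L : R, (0 < L)%R -> omega phi < L%:E -> kappa phi <= (C * L)%:E) ->
  separation_ratio phi <= C%:E.
Proof.
move=> C0 H; rewrite /separation_ratio.
have := omega_ge0 phi x; have := kappa_ge0 phi.
case: (omega phi) H => [r|_ _ _|//]; last by rewrite div_pinfty lee_fin.
move=> H k0; rewrite lee_fin => r0.
have kle : kappa phi <= (C * r)%:E.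
  apply/lee_addgt0Pr => e e0; rewrite -EFinD.
  have De : (0 < e / (C + 1))%R by rewrite divr_gt0// ltr_wpDl.
  apply: le_trans (H (r + e / (C + 1))%R _ _) _.
  - by rewrite ltr_wpDl.
  - by rewrite lte_fin ltrDl.
  rewrite lee_fin mulrDr lerD2l mulrCA ler_piMr//; first exact: ltW.
  by rewrite ler_pdivrMr ?ltr_wpDl// mul1r lerDl.
move: r0; rewrite le_eqVlt => /predU1P[r0|r0].
  have -> : kappa phi = 0.
    by apply/eqP; rewrite eq_le k0 andbT; move: kle; rewrite -r0 mulr0.
  by rewrite mul0e lee_fin.
by rewrite inver gt_eqF// lee_pdivrMr.
Qed.

Lemma nonreflexive_kappa_le {R : realType} (X : completeNormedModType R)
    (phi : norm_metric X -> norm_metric (tsirelson_dual R)) (L : R) :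
  ~ reflexive_space X -> (0 < L)%R -> omega phi < L%:E -> kappa phi <= (5 * L)%:E.
Proof.
move=> /nonreflexive_james[x [M [c [c0 xM xc]]]] L0.
move=> /ereal_inf_lt[_ [t /= t0 <-] tL].
have phiL (y z : X) : (`|y - z| <= t)%R -> (`|(phi y : tsirelson_dual R) - phi z| <= L)%R.
  move=> yz; rewrite -lee_fin; apply: le_trans (ltW tL).
  by apply: ereal_sup_ubound; exists (y, z).
apply: ge_ereal_sup => _ [T /= T0 <-].
have M0 : (0 <= M)%R by exact: le_trans (xM 0%N).
pose a := (t / (2 * (M + 1)))%R.
have a0 : (0 < a)%R by rewrite divr_gt0// mulr_gt0// ltr_wpDl.
pose S (s : seq nat) : X := (a *: \sum_(i <- s) x i)%R.
pose g s : dual_space (c00 R) := dual_restrict (phi (S s)).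
have gL s1 n m s2 : (`|g (s1 ++ n :: s2) - g (s1 ++ m :: s2)| <= L)%R.
  rewrite dual_restrictB dual_restrict_norm; apply: phiL.
  rewrite /S -scalerBr !big_cat !big_cons /= opprD addrACA subrr add0r.
  rewrite opprD addrACA subrr addr0 normrZ gtr0_norm//.
  have : (`|x n - x m| <= 2 * (M + 1))%R.
    by apply: le_trans (ler_normB _ _) _; have := xM n; have := xM m; lra.
  move=> /(ler_wpM2l (ltW a0)) /le_trans; apply.
  by rewrite /a divfK// gt_eqF// mulr_gt0// ltr_wpDl.
have [d dT] : exists d : nat, (T <= a * (c * d%:R))%R.
  exists (Num.truncn (T / (a * c))).+1.
  by rewrite mulrA mulrC -(ler_pdivrMr _ _ (mulr_gt0 a0 c0)) ltW// truncnS_gt.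
have [p [s1 [s2 [s1d s2d s1p s2p gs]]]] := tsirelson_concentration d L0 gL.
apply: (@le_trans _ _ (`|(phi (S s2) : tsirelson_dual R) - phi (S s1)|)%:E).
  apply: ereal_inf_lbound; exists (S s2, S s1) => //=.
  apply: le_trans dT _; rewrite [leRHS](_ : _ = `|S s2 - S s1|)%R//.
  rewrite /S -scalerBr normrZ gtr0_norm// ler_pM2l// -s1d.
  by apply: (xc p) => //; rewrite s1d.
by rewrite lee_fin -dual_restrict_norm -dual_restrictB.
Qed.

Theorem proposition4p10 (R : realType) :
  (forall X : completeNormedModType R, ~ reflexive_space X ->
     coarse_embeddability_ratio (norm_metric X)
       (norm_metric (tsirelson_dual R)) <= 5%:E) /\
  coarse_embeddability_ratio (norm_metric (c0 R))
    (norm_metric (tsirelson_dual R)) <= 5%:E /\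
  coarse_embeddability_ratio (norm_metric (linf R))
    (norm_metric (tsirelson_dual R)) <= 5%:E.
Proof.
have main (X : completeNormedModType R) : ~ reflexive_space X ->
    coarse_embeddability_ratio (norm_metric X)
      (norm_metric (tsirelson_dual R)) <= 5%:E.
  move=> nrX; apply: ge_ereal_sup => _ [phi _ <-].
  apply: (@separation_ratio_le _ _ _ phi (0%R : X) 5%R) => // L L0 oL.
  exact: nonreflexive_kappa_le.
have [U [UU Uoo]] := ultraFilterLemma (@eventually_filter).
split=> //; split; apply: main; first exact: (c0_nonreflexive Uoo).
exact: (linf_nonreflexive Uoo).
Qed.
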